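(* Let $\mathsf{C}$ be a strict symmetric monoidal category and let $D$, $B$, $Y$ be Hopf coquasigroups in $\mathsf{C}$ such that the antipodes of $D$ and $B$ are isomorphisms. Then $Y$ cofactorizes as $Y=D\bullet B$ if and only if there exists a comatched pair of Hopf coquasigroups $(B,D)$ such that $Y$ is isomorphic to the double cross coproduct $D\infty B$ as Hopf coquasigroups.
   Context: $\mathsf{C}$ is a strict symmetric monoidal category with tensor product $\otimes$, unit object $K$ and symmetry $c$. For an object $P$ and a morphism $f$, write $P\otimes f$ for $id_P\otimes f$ and $f\otimes P$ for $f\otimes id_P$. Monoid: $(D,\eta_D,\mu_D)$, unital and associative. Counital comagma: $(D,\varepsilon_D:D\to K,\delta_D:D\to D\otimes D)$ with $(\varepsilon_D\otimes D)\circ\delta_D=id_D=(D\otimes\varepsilon_D)\circ\delta_D$ (no coassociativity required). Tensor products: $\eta_{A\otimes B}=\eta_A\otimes\eta_B$, $\mu_{A\otimes B}=(\mu_A\otimes\mu_B)\circ(A\otimes c_{B,A}\otimes B)$, $\varepsilon_{D\otimes E}=\varepsilon_D\otimes\varepsilon_E$, $\delta_{D\otimes E}=(D\otimes c_{D,E}\otimes E)\circ(\delta_D\otimes\delta_E)$. Hopf coquasigroup $D$ in $\mathsf{C}$: a monoid $(D,\eta_D,\mu_D)$ and counital comagma $(D,\varepsilon_D,\delta_D)$ such that $\eta_D$ and $\mu_D$ are morphisms of counital comagmas (equivalently $\varepsilon_D$, $\delta_D$ preserve units and products), together with a morphism $\lambda_D:D\to D$ (antipode) such that $$(D\otimes\mu_D)\circ(\delta_D\otimes\lambda_D)\circ\delta_D=D\otimes\eta_D=(D\otimes\mu_D)\circ(D\otimes\lambda_D\otimes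 D)\circ(\delta_D\otimes D)\circ\delta_D,$$ $$(\mu_D\otimes D)\circ(\lambda_D\otimes\delta_D)\circ\delta_D=\eta_D\otimes D=(\mu_D\otimes D)\circ(D\otimes\lambda_D\otimes D)\circ(D\otimes\delta_D)\circ\delta_D.$$ A morphism of Hopf coquasigroups is a morphism of monoids and counital comagmas. Cofactorization: $Y$ cofactorizes as $Y=D\bullet B$ if there exist Hopf coquasigroup epimorphisms $p_D:Y\to D$ and $p_B:Y\to B$ such that, writing $u_Y=(p_D\otimes p_B)\circ\delta_Y:Y\to D\otimes B$ and $v_Y=(p_B\otimes p_D)\circ\delta_Y:Y\to B\otimes D$, the morphism $u_Y$ is an isomorphism and 1. $(Y\otimes u_Y)\circ\delta_Y=(((Y\otimes p_D)\circ\delta_Y)\otimes p_B)\circ\delta_Y$, 2. $(u_Y\otimes Y)\circ\delta_Y=(p_D\otimes((p_B\otimes Y)\circ\delta_Y))\circ\delta_Y$, 3. $(Y\otimes((\lambda_B\otimes\lambda_D)\circ v_Y))\circ\delta_Y=(((Y\otimes(\lambda_B\circ p_B))\circ\delta_Y)\otimes(\lambda_D\circ p_D))\circ\delta_Y$, 4. $(((\lambda_B\otimes\lambda_D)\circ v_Y)\otimes Y)\circ\delta_Y=((\lambda_B\circ p_B)\otimes(((\lambda_D\circ p_D)\otimes Y)\circ\delta_Y))\circ\delta_Y$. Right $D$-comodule monoid $(B,\rho_B)$, $\rho_B:B\to B\otimes D$: $(B\otimes\varepsilon_D)\circ\rho_B=id_B$, $(\rho_B\otimes D)\circ\rho_B=(B\otimes\delta_D)\circ\rho_B$,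 $\rho_B\circ\eta_B=\eta_B\otimes\eta_D$, $\rho_B\circ\mu_B=(\mu_B\otimes D)\circ\rho_{B\otimes B}$ where $\rho_{B\otimes B}=(B\otimes B\otimes\mu_D)\circ(B\otimes c_{D,B}\otimes D)\circ(\rho_B\otimes\rho_B)$. Left $B$-comodule monoid $(D,r_D)$, $r_D:D\to B\otimes D$: $(\varepsilon_B\otimes D)\circ r_D=id_D$, $(B\otimes r_D)\circ r_D=(\delta_B\otimes D)\circ r_D$, $r_D\circ\eta_D=\eta_B\otimes\eta_D$, $r_D\circ\mu_D=\mu_{B\otimes D}\circ(r_D\otimes r_D)$. Comatched pair of Hopf coquasigroups $(B,D)$: Hopf coquasigroups $B$, $D$ with a right $D$-comodule monoid structure $(B,\rho_B)$ and a left $B$-comodule monoid structure $(D,r_D)$ such that, with $\Omega=\mu_{B\otimes D}\circ(r_D\otimes\rho_B):D\otimes B\to B\otimes D$, - $(\varepsilon_B\otimes D)\circ\rho_B=\varepsilon_B\otimes\eta_D$, $\quad(B\otimes\varepsilon_D)\circ r_D=\eta_B\otimes\varepsilon_D$, - $\mu_{B\otimes D}\circ(\rho_B\otimes r_D)=\Omega\circ c_{B,D}$, - $(B\otimes\lambda_B\otimes\lambda_D)\circ(\delta_B\otimes D)\circ\rho_B=(B\otimes((\lambda_B\otimes\lambda_D)\circ\Omega))\circ(\rho_B\otimes B)\circ\delta_B$, - $(D\otimes B\otimes\mu_D)\circ(D\otimes\Omega\otimes\lambda_D)\circ(\delta_D\otimes r_D)\circ\delta_D=D\otimes\eta_B\otimes\eta_D$,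 - $(D\otimes B\otimes(\mu_D\circ(\lambda_D\otimes D)))\circ(D\otimes\Omega\otimes D)\circ(\delta_D\otimes r_D)\circ\delta_D=D\otimes\eta_B\otimes\eta_D$, - $(\lambda_B\otimes\lambda_D\otimes D)\circ(B\otimes\delta_D)\circ r_D=(((\lambda_B\otimes\lambda_D)\circ\Omega)\otimes D)\circ(D\otimes r_D)\circ\delta_D$, - $(\mu_B\otimes D\otimes B)\circ(\lambda_B\otimes\Omega\otimes B)\circ(\rho_B\otimes\delta_B)\circ\delta_B=\eta_B\otimes\eta_D\otimes B$, - $((\mu_B\circ(B\otimes\lambda_B))\otimes D\otimes B)\circ(B\otimes\Omega\otimes B)\circ(\rho_B\otimes\delta_B)\circ\delta_B=\eta_B\otimes\eta_D\otimes B$. Double cross coproduct: for a comatched pair $(B,D)$, $D\infty B$ is the object $D\otimes B$ with coproduct $(D\otimes\Omega\otimes B)\circ(\delta_D\otimes\delta_B)$, counit $\varepsilon_D\otimes\varepsilon_B$, unit $\eta_{D\otimes B}$, product $\mu_{D\otimes B}$ and antipode $c_{B,D}\circ(\lambda_B\otimes\lambda_D)\circ\Omega$; it is known to be a Hopf coquasigroup. *)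

(* Defs.v *)
Set Implicit Arguments.
Unset Strict Implicit.
Unset Printing Implicit Defensive.

(* A category is presented by a type of objects, a single type of arrows, and
   domain and codomain maps, so that the strict laws of a strict monoidal
   category are plain equalities of objects and of arrows, without transports
   along equalities of objects.  Composition is a total function whose value is
   unconstrained on non-composable pairs: every axiom below has the
   composability of the arrows as a hypothesis. *)
Record category := Category {
  ob : Type;
  mor : Type;
  dom : mor -> ob;
  cod : mor -> ob;
  idm : ob -> mor;
  comp : mor -> mor -> mor;
  dom_id : forall A, dom (idm A) = A;
  cod_id : forall A, cod (idm A) = A;
  dom_comp : forall g f, cod f = dom g -> dom (comp g f) = dom f;
  cod_comp : forall g f, cod f = dom g -> cod (comp g f) = cod g;
  comp_assoc : forall h g f, cod f = dom g -> cod g = dom h ->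
    comp h (comp g f) = comp (comp h g) f;
  comp_id_l : forall f, comp (idm (cod f)) f = f;
  comp_id_r : forall f, comp f (idm (dom f)) = f
}.

Declare Scope ob_scope.
Delimit Scope ob_scope with ob.
Bind Scope ob_scope with ob.
Declare Scope mor_scope.
Delimit Scope mor_scope with mor.
Bind Scope mor_scope with mor.

(* As in the usual convention, an object also denotes its identity arrow. *)
Coercion idm : ob >-> mor.
Arguments idm {c} _.

Notation "g ∘ f" := (comp g f) (at level 40, left associativity) : mor_scope.

Definition hom (C : category) (A B : ob C) (f : mor C) : Prop :=
  dom f = A /\ cod f = B.

Definition is_iso (C : category) (f : mor C) : Prop :=
  exists g : mor C, hom (cod f) (dom f) g /\
    (g ∘ f)%mor = idm (dom f) /\ (f ∘ g)%mor = idm (cod f).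

Definition is_epi (C : category) (f : mor C) : Prop :=
  forall g h : mor C, dom g = cod f -> dom h = cod f -> cod g = cod h ->
    (g ∘ f)%mor = (h ∘ f)%mor -> g = h.

Record ssmcat := SSMCat {
  ssm_cat :> category;
  tob : ob ssm_cat -> ob ssm_cat -> ob ssm_cat;
  tmor : mor ssm_cat -> mor ssm_cat -> mor ssm_cat;
  K : ob ssm_cat;
  sym : ob ssm_cat -> ob ssm_cat -> mor ssm_cat;
  (* the tensor product is a bifunctor *)
  dom_tens : forall f g, dom (tmor f g) = tob (dom f) (dom g);
  cod_tens : forall f g, cod (tmor f g) = tob (cod f) (cod g);
  tens_id : forall A B, tmor (idm A) (idm B) = idm (tob A B);
  tens_comp : forall f g f' g', cod f = dom g -> cod f' = dom g' ->
    tmor (comp g f) (comp g' f') = comp (tmor g g') (tmor f f');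
  (* strict associativity and unitality *)
  tob_assoc : forall A B E, tob A (tob B E) = tob (tob A B) E;
  tob_unit_l : forall A, tob K A = A;
  tob_unit_r : forall A, tob A K = A;
  tens_assoc : forall f g h, tmor f (tmor g h) = tmor (tmor f g) h;
  tens_unit_l : forall f, tmor (idm K) f = f;
  tens_unit_r : forall f, tmor f (idm K) = f;
  (* symmetry: a natural involutive isomorphism satisfying the (strict)
     hexagon identity; the other hexagon and the unit coherence follow *)
  sym_hom : forall A B, hom (tob A B) (tob B A) (sym A B);
  sym_nat : forall f g,
    comp (sym (cod f) (cod g)) (tmor f g)
    = comp (tmor g f) (sym (dom f) (dom g));
  sym_inv : forall A B, comp (sym B A) (sym A B) = idm (tob A B);
  sym_hexagon : forall A B E,
    sym A (tob B E) = comp (tmor (idm B) (sym A E)) (tmor (sym A B) (idm E))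
}.

Arguments K {s}.

Notation "A ⊗ B" := (tob A B) (at level 38, left associativity) : ob_scope.
Notation "f ⊗ g" := (tmor f g) (at level 38, left associativity) : mor_scope.

Local Open Scope mor_scope.

Record monoid_data (C : ssmcat) (D : ob C) := MonoidData {
  eta : mor C;
  mu : mor C
}.

Record comagma_data (C : ssmcat) (D : ob C) := ComagmaData {
  eps : mor C;
  delta : mor C
}.

Record is_monoid (C : ssmcat) (D : ob C) (M : monoid_data D) : Prop :=
  IsMonoid {
  eta_typed : hom K D (eta M);
  mu_typed : hom (D ⊗ D) D (mu M);
  mu_unit_l : mu M ∘ (eta M ⊗ D) = D;
  mu_unit_r : mu M ∘ (D ⊗ eta M) = D;
  mu_assoc : mu M ∘ (mu M ⊗ D) = mu M ∘ (D ⊗ mu M)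
}.

Record is_comagma (C : ssmcat) (D : ob C) (M : comagma_data D) : Prop :=
  IsComagma {
  eps_typed : hom D K (eps M);
  delta_typed : hom D (D ⊗ D) (delta M);
  delta_counit_l : (eps M ⊗ D) ∘ delta M = D;
  delta_counit_r : (D ⊗ eps M) ∘ delta M = D
}.

Definition tens_monoid (C : ssmcat) (A B : ob C)
    (M : monoid_data A) (N : monoid_data B) : monoid_data (A ⊗ B) :=
  MonoidData _ (eta M ⊗ eta N) ((mu M ⊗ mu N) ∘ (A ⊗ sym B A ⊗ B)).

Definition tens_comagma (C : ssmcat) (D E : ob C)
    (M : comagma_data D) (N : comagma_data E) : comagma_data (D ⊗ E) :=
  ComagmaData _ (eps M ⊗ eps N) ((D ⊗ sym D E ⊗ E) ∘ (delta M ⊗ delta N)).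

Definition unit_comagma (C : ssmcat) : comagma_data (K : ob C) :=
  ComagmaData _ (idm K) (idm K).

Record monoid_hom (C : ssmcat) (D E : ob C)
    (M : monoid_data D) (N : monoid_data E) (f : mor C) : Prop := MonoidHom {
  monoid_hom_typed : hom D E f;
  monoid_hom_eta : f ∘ eta M = eta N;
  monoid_hom_mu : f ∘ mu M = mu N ∘ (f ⊗ f)
}.

Record comagma_hom (C : ssmcat) (D E : ob C)
    (M : comagma_data D) (N : comagma_data E) (f : mor C) : Prop := ComagmaHom {
  comagma_hom_typed : hom D E f;
  comagma_hom_eps : eps N ∘ f = eps M;
  comagma_hom_delta : delta N ∘ f = (f ⊗ f) ∘ delta M
}.

Record hcq_data (C : ssmcat) := HcqData {
  hcq_ob :> ob C;
  hcq_monoid :> monoid_data hcq_ob;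
  hcq_comagma :> comagma_data hcq_ob;
  lam : mor C
}.

Record is_hcq (C : ssmcat) (D : hcq_data C) : Prop := IsHcq {
  hcq_is_monoid : is_monoid D;
  hcq_is_comagma : is_comagma D;
  hcq_eta_hom : comagma_hom (unit_comagma C) D (eta D);
  hcq_mu_hom : comagma_hom (tens_comagma D D) D (mu D);
  lam_typed : hom D D (lam D);
  antipode_r1 :
    (D ⊗ mu D) ∘ (delta D ⊗ lam D) ∘ delta D = D ⊗ eta D;
  antipode_r2 :
    (D ⊗ mu D) ∘ (D ⊗ lam D ⊗ D) ∘ (delta D ⊗ D) ∘ delta D = D ⊗ eta D;
  antipode_l1 :
    (mu D ⊗ D) ∘ (lam D ⊗ delta D) ∘ delta D = eta D ⊗ D;
  antipode_l2 :
    (mu D ⊗ D) ∘ (D ⊗ lam D ⊗ D) ∘ (D ⊗ delta D) ∘ delta D = eta D ⊗ D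
}.

Record hopf_coquasigroup (C : ssmcat) := HopfCoquasigroup {
  hcq_struct :> hcq_data C;
  hcq_laws : is_hcq hcq_struct
}.

(* Morphisms of Hopf coquasigroups do not mention the antipode (which they
   automatically preserve) nor the laws of the source and target. *)
Definition hcq_hom (C : ssmcat) (D E : hcq_data C) (f : mor C) : Prop :=
  monoid_hom D E f /\ comagma_hom D E f.

Definition hcq_isomorphic (C : ssmcat) (D E : hcq_data C) : Prop :=
  exists f g : mor C, hcq_hom D E f /\ hcq_hom E D g /\
    g ∘ f = idm D /\ f ∘ g = idm E.

Section Cofactorization.

Variables (C : ssmcat) (Y D B : hopf_coquasigroup C).
Variables (pD pB : mor C).

Definition cofact_u : mor C := (pD ⊗ pB) ∘ delta Y.
Definition cofact_v : mor C := (pB ⊗ pD) ∘ delta Y.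

Local Notation u := cofact_u.
Local Notation v := cofact_v.

Record is_cofactorization : Prop := IsCofactorization {
  cofact_pD_hom : hcq_hom Y D pD;
  cofact_pD_epi : is_epi pD;
  cofact_pB_hom : hcq_hom Y B pB;
  cofact_pB_epi : is_epi pB;
  cofact_u_iso : is_iso u;
  cofact_1 :
    (Y ⊗ u) ∘ delta Y = (((Y ⊗ pD) ∘ delta Y) ⊗ pB) ∘ delta Y;
  cofact_2 :
    (u ⊗ Y) ∘ delta Y = (pD ⊗ ((pB ⊗ Y) ∘ delta Y)) ∘ delta Y;
  cofact_3 :
    (Y ⊗ ((lam B ⊗ lam D) ∘ v)) ∘ delta Y
    = (((Y ⊗ (lam B ∘ pB)) ∘ delta Y) ⊗ (lam D ∘ pD)) ∘ delta Y;
  cofact_4 :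
    (((lam B ⊗ lam D) ∘ v) ⊗ Y) ∘ delta Y
    = ((lam B ∘ pB) ⊗ (((lam D ∘ pD) ⊗ Y) ∘ delta Y)) ∘ delta Y
}.

End Cofactorization.

Definition cofactorizes (C : ssmcat) (Y D B : hopf_coquasigroup C) : Prop :=
  exists pD pB : mor C, is_cofactorization Y D B pD pB.

Record is_right_comodule_monoid (C : ssmcat) (D B : hopf_coquasigroup C)
    (rho : mor C) : Prop := IsRightComoduleMonoid {
  rho_typed : hom B (B ⊗ D) rho;
  rho_counit : (B ⊗ eps D) ∘ rho = B;
  rho_coassoc : (rho ⊗ D) ∘ rho = (B ⊗ delta D) ∘ rho;
  rho_eta : rho ∘ eta B = eta B ⊗ eta D;
  rho_mu : rho ∘ mu B
    = (mu B ⊗ D) ∘ ((B ⊗ B ⊗ mu D) ∘ (B ⊗ sym D B ⊗ D) ∘ (rho ⊗ rho))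
}.

Record is_left_comodule_monoid (C : ssmcat) (B D : hopf_coquasigroup C)
    (r : mor C) : Prop := IsLeftComoduleMonoid {
  r_typed : hom D (B ⊗ D) r;
  r_counit : (eps B ⊗ D) ∘ r = D;
  r_coassoc : (B ⊗ r) ∘ r = (delta B ⊗ D) ∘ r;
  r_eta : r ∘ eta D = eta B ⊗ eta D;
  r_mu : r ∘ mu D = mu (tens_monoid B D) ∘ (r ⊗ r)
}.

Section ComatchedPair.

Variables (C : ssmcat) (B D : hopf_coquasigroup C).
Variables (rho r : mor C).

Definition Omega : mor C := mu (tens_monoid B D) ∘ (r ⊗ rho).

Record is_comatched_pair : Prop := IsComatchedPair {
  cm_rho : is_right_comodule_monoid D B rho;
  cm_r : is_left_comodule_monoid B D r;
  cm_rho_eps : (eps B ⊗ D) ∘ rho = eps B ⊗ eta D;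
  cm_r_eps : (B ⊗ eps D) ∘ r = eta B ⊗ eps D;
  cm_comm : mu (tens_monoid B D) ∘ (rho ⊗ r) = Omega ∘ sym B D;
  cm_rho_delta :
    (B ⊗ lam B ⊗ lam D) ∘ (delta B ⊗ D) ∘ rho
    = (B ⊗ ((lam B ⊗ lam D) ∘ Omega)) ∘ (rho ⊗ B) ∘ delta B;
  cm_antipode_D1 :
    (D ⊗ B ⊗ mu D) ∘ (D ⊗ Omega ⊗ lam D) ∘ (delta D ⊗ r) ∘ delta D
    = D ⊗ eta B ⊗ eta D;
  cm_antipode_D2 :
    (D ⊗ B ⊗ (mu D ∘ (lam D ⊗ D))) ∘ (D ⊗ Omega ⊗ D)
      ∘ (delta D ⊗ r) ∘ delta D
    = D ⊗ eta B ⊗ eta D;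
  cm_r_delta :
    (lam B ⊗ lam D ⊗ D) ∘ (B ⊗ delta D) ∘ r
    = (((lam B ⊗ lam D) ∘ Omega) ⊗ D) ∘ (D ⊗ r) ∘ delta D;
  cm_antipode_B1 :
    (mu B ⊗ D ⊗ B) ∘ (lam B ⊗ Omega ⊗ B) ∘ (rho ⊗ delta B) ∘ delta B
    = eta B ⊗ eta D ⊗ B;
  cm_antipode_B2 :
    ((mu B ∘ (B ⊗ lam B)) ⊗ D ⊗ B) ∘ (B ⊗ Omega ⊗ B)
      ∘ (rho ⊗ delta B) ∘ delta B
    = eta B ⊗ eta D ⊗ B
}.

Definition double_cross_coproduct : hcq_data C :=
  @HcqData C (D ⊗ B)
    (tens_monoid D B)
    (ComagmaData _ (eps D ⊗ eps B) ((D ⊗ Omega ⊗ B) ∘ (delta D ⊗ delta B)))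
    (sym B D ∘ (lam B ⊗ lam D) ∘ Omega).

End ComatchedPair.

(* Main.v *)
(* Write [Om] for the composite [v ∘ u⁻¹ : D ⊗ B -> B ⊗ D], or for [Omega] of a
   comatched pair.  Both directions rest on the same facts: [Om] is a morphism
   of monoids, hence determined by its restrictions [r] to [D] and [rho] to
   [B], and it is compatible with both coproducts,
     (delta B ⊗ D) ∘ Om = (B ⊗ Om) ∘ (Om ⊗ B) ∘ (D ⊗ delta B),
     (B ⊗ delta D) ∘ Om = (Om ⊗ D) ∘ (D ⊗ Om) ∘ (delta D ⊗ B).
   For a cofactorization these identities replace the coassociativity that [Y]
   lacks: they follow from its four axioms after cancelling the antipodes, and
   restricting them, together with the antipode axioms of [Y], to [D] and to
   [B] gives the comatched pair, with [u] the isomorphism onto the double cross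
   coproduct.  For a comatched pair both sides of each identity are monoid
   morphisms that agree on [D] and on [B]; the projections of [D ⊗ B], composed
   with the given isomorphism, then cofactorize [Y]. *)

From Stdlib Require Import Bool List Arith.
Require Import Defs.
Import ListNotations.

Set Implicit Arguments.
Unset Strict Implicit.
Unset Printing Implicit Defensive.

Local Open Scope mor_scope.

(** * Typing of arrows, and the category and tensor laws for typed arrows *)

Lemma hom_id (C : category) (A : ob C) : hom A A (idm A).
Proof. split; [apply dom_id | apply cod_id]. Qed.

Lemma hom_comp (C : category) (A B E : ob C) (g f : mor C) :
  hom B E g -> hom A B f -> hom A E (g ∘ f).
Proof.
intros [gB gE] [fA fB]; split.
- rewrite dom_comp; congruence.
- rewrite cod_comp; congruence.
Qed.

Lemma hom_tens (C : ssmcat) (A B A' B' : ob C) (f g : mor C) :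
  hom A B f -> hom A' B' g -> hom (A ⊗ A') (B ⊗ B') (f ⊗ g).
Proof.
intros [fA fB] [gA gB]; split.
- rewrite dom_tens; congruence.
- rewrite cod_tens; congruence.
Qed.

Lemma comp_hom_id_l (C : category) (A B : ob C) (f : mor C) :
  hom A B f -> idm B ∘ f = f.
Proof. intros [<- <-]; apply comp_id_l. Qed.

Lemma comp_hom_id_r (C : category) (A B : ob C) (f : mor C) :
  hom A B f -> f ∘ idm A = f.
Proof. intros [<- <-]; apply comp_id_r. Qed.

Lemma hom_comp_assoc (C : category) (A B E F : ob C) (h g f : mor C) :
  hom A B f -> hom B E g -> hom E F h -> h ∘ (g ∘ f) = h ∘ g ∘ f.
Proof. intros [_ fB] [gB gE] [hE _]; apply comp_assoc; congruence. Qed.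

Lemma interchange (C : ssmcat) (A B E A' B' E' : ob C) (f g f' g' : mor C) :
  hom A B f -> hom B E g -> hom A' B' f' -> hom B' E' g' ->
  (g ⊗ g') ∘ (f ⊗ f') = (g ∘ f) ⊗ (g' ∘ f').
Proof.
intros [_ fB] [gB _] [_ fB'] [gB' _]; symmetry; apply tens_comp; congruence.
Qed.

(** * Equality of diagrams in a strict monoidal category, by reflection *)

Inductive oexpr := OUnit | OAtom (n : nat) | OTens (a b : oexpr).

Fixpoint flat (o : oexpr) : list nat :=
  match o with
  | OUnit => []
  | OAtom n => [n]
  | OTens a b => flat a ++ flat b
  end.

Inductive expr :=
  | EId (o : oexpr)
  | EGen (n : nat)
  | EComp (g f : expr)
  | ETens (f g : expr).

(* The layer [(l, n, r)] is generator [n] with the identity wires [l] on its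
   left and [r] on its right; a list of layers is read in order of
   application. *)
Definition layer : Type := list nat * nat * list nat.

Definition same (l m : list nat) : bool :=
  if list_eq_dec Nat.eq_dec l m then true else false.

Lemma sameP l m : same l m = true -> l = m.
Proof. unfold same; destruct list_eq_dec; easy. Qed.

Section Normalization.

Variable tys : list (oexpr * oexpr).

Definition src (n : nat) : list nat := flat (fst (nth n tys (OUnit, OUnit))).
Definition tgt (n : nat) : list nat := flat (snd (nth n tys (OUnit, OUnit))).

Fixpoint edom (e : expr) : list nat :=
  match e with
  | EId o => flat o
  | EGen n => src n
  | EComp _ f => edom f
  | ETens f g => edom f ++ edom g
  end.

Fixpoint ecod (e : expr) : list nat :=
  match e with
  | EId o => flat o
  | EGen n => tgt n
  | EComp g _ => ecod g
  | ETens f g => ecod f ++ ecod g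
  end.

(** Composition is unconstrained on non-composable pairs, and [edom] and [ecod] look at one factor
    of a composite only. Slicing an expression into layers is therefore sound only after this
    check. *)
Fixpoint well_typed (e : expr) : bool :=
  match e with
  | EComp g f => well_typed g && well_typed f && same (ecod f) (edom g)
  | ETens f g => well_typed f && well_typed g
  | _ => true
  end.

Definition whisker_l (w : list nat) (x : layer) : layer :=
  let '(l, n, r) := x in (w ++ l, n, r).
Definition whisker_r (w : list nat) (x : layer) : layer :=
  let '(l, n, r) := x in (l, n, r ++ w).

Fixpoint layers (e : expr) : list layer :=
  match e with
  | EId _ => []
  | EGen n => [([], n, [])]
  | EComp g f => layers f ++ layers g
  | ETens f g =>
      map (whisker_r (edom g)) (layers f) ++ map (whisker_l (ecod f)) (layers g)
  end.

(** Interchange law: [x] is applied first, but [y] acts entirely to its left, with the wires [m]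
    between the two generators, so [y] may go first. The value of [m] is a guess read off by
    lengths, and the two tests confirm it. *)
Definition swap (x y : layer) : option (layer * layer) :=
  let '(l1, n1, r1) := x in
  let '(l2, n2, r2) := y in
  let m := skipn (length l2 + length (src n2)) l1 in
  if same l1 (l2 ++ src n2 ++ m) && same r2 (m ++ tgt n1 ++ r1)
  then Some ((l2, n2, m ++ src n1 ++ r1), (l2 ++ tgt n2 ++ m, n1, r1))
  else None.

Fixpoint insert (x : layer) (s : list layer) : list layer :=
  match s with
  | [] => [x]
  | y :: s' =>
      match swap x y with
      | Some (y', x') => y' :: insert x' s'
      | None => x :: y :: s'
      end
  end.

Definition pass (s : list layer) : list layer := fold_right insert [] s.

(* Moving the leftmost generators first is a normal form on connected diagrams
   only, which is why the decision procedure below is merely sound. *)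
Definition normal (s : list layer) : list layer :=
  Nat.iter (length s) pass s.

Definition layer_eq_dec (x y : layer) : {x = y} + {x <> y}.
Proof. repeat decide equality. Defined.

Definition same_diagram (e f : expr) : bool :=
  well_typed e && well_typed f && same (edom e) (edom f)
  && (if list_eq_dec layer_eq_dec (normal (layers e)) (normal (layers f))
      then true else false).

Fixpoint wf (a : list nat) (s : list layer) (b : list nat) : Prop :=
  match s with
  | [] => a = b
  | (l, n, r) :: s' => a = l ++ src n ++ r /\ wf (l ++ tgt n ++ r) s' b
  end.

Lemma wf_app s t a b c : wf a s b -> wf b t c -> wf a (s ++ t) c.
Proof.
revert a; induction s as [|[[l n] r] s IH]; simpl; intros a; [now intros ->|].
intros [-> Hs] Ht; eauto.
Qed.

Lemma wf_whisker_l w s a b :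
  wf a s b -> wf (w ++ a) (map (whisker_l w) s) (w ++ b).
Proof.
revert a; induction s as [|[[l n] r] s IH]; simpl; intros a; [now intros ->|].
intros [-> Hs]; rewrite <- !app_assoc; split; [easy|].
now apply IH.
Qed.

Lemma wf_whisker_r w s a b :
  wf a s b -> wf (a ++ w) (map (whisker_r w) s) (b ++ w).
Proof.
revert a; induction s as [|[[l n] r] s IH]; simpl; intros a; [now intros ->|].
intros [-> Hs]; split; [now rewrite <- !app_assoc|].
apply IH in Hs; now rewrite <- !app_assoc in Hs.
Qed.

Variables (C : ssmcat) (obs : list (ob C)) (arrs : list (mor C)).

Fixpoint oeval (o : oexpr) : ob C :=
  match o with
  | OUnit => K
  | OAtom n => nth n obs K
  | OTens a b => tob (oeval a) (oeval b)
  end.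

Fixpoint leval (l : list nat) : ob C :=
  match l with
  | [] => K
  | n :: l' => tob (nth n obs K) (leval l')
  end.

Lemma leval_app l m : leval (l ++ m) = tob (leval l) (leval m).
Proof.
induction l as [|n l IH]; simpl; [now rewrite tob_unit_l|].
now rewrite IH, tob_assoc.
Qed.

Lemma oeval_flat o : oeval o = leval (flat o).
Proof.
induction o as [|n|a IHa b IHb]; simpl; [easy|now rewrite tob_unit_r|].
now rewrite leval_app, IHa, IHb.
Qed.

Definition arr (n : nat) : mor C := nth n arrs (idm K).

Fixpoint eval (e : expr) : mor C :=
  match e with
  | EId o => idm (oeval o)
  | EGen n => arr n
  | EComp g f => eval g ∘ eval f
  | ETens f g => eval f ⊗ eval g
  end.

Hypothesis arrs_typed :
  Forall2 (fun f t => hom (oeval (fst t)) (oeval (snd t)) f) arrs tys.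

(** No bound on [n] is needed: out of range, the default arrow [idm K] matches the default type
    [(OUnit, OUnit)]. *)
Lemma arr_typed n : hom (leval (src n)) (leval (tgt n)) (arr n).
Proof.
unfold arr, src, tgt; rewrite <- !oeval_flat.
revert n; induction arrs_typed as [|f t fs ts Hf Ht IH]; intros [|n]; simpl;
  auto using hom_id.
Qed.

Definition leval_layer (x : layer) : mor C :=
  let '(l, n, r) := x in leval l ⊗ arr n ⊗ leval r.

Lemma leval_layer_typed l n r :
  hom (leval (l ++ src n ++ r)) (leval (l ++ tgt n ++ r)) (leval_layer (l, n, r)).
Proof.
rewrite !leval_app, !tob_assoc; simpl.
repeat apply hom_tens; auto using hom_id, arr_typed.
Qed.

(** The source is an argument because an empty list of layers does not determine its wires. *)
Fixpoint ev (a : list nat) (s : list layer) : mor C :=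
  match s with
  | [] => idm (leval a)
  | (l, n, r) :: s' => ev (l ++ tgt n ++ r) s' ∘ leval_layer (l, n, r)
  end.

Lemma ev_typed s a b : wf a s b -> hom (leval a) (leval b) (ev a s).
Proof.
revert a; induction s as [|[[l n] r] s IH]; intros a.
- intros ->; apply hom_id.
- intros [-> Hs]; exact (hom_comp (IH _ Hs) (leval_layer_typed l n r)).
Qed.

Lemma ev_app s t a b c :
  wf a s b -> wf b t c -> ev a (s ++ t) = ev b t ∘ ev a s.
Proof.
revert a; induction s as [|[[l n] r] s IH]; intros a.
- intros <- Ht; simpl; symmetry; exact (comp_hom_id_r (ev_typed Ht)).
- intros [-> Hs] Ht; cbn [ev app]; rewrite (IH _ Hs Ht); symmetry.
  exact (hom_comp_assoc (leval_layer_typed l n r) (ev_typed Hs) (ev_typed Ht)).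
Qed.

Lemma ev_whisker_l w s a b :
  wf a s b -> ev (w ++ a) (map (whisker_l w) s) = leval w ⊗ ev a s.
Proof.
revert a; induction s as [|[[l n] r] s IH]; intros a.
- intros ->; simpl; now rewrite leval_app, tens_id.
- intros [-> Hs]; cbn [ev map whisker_l]; rewrite <- app_assoc, (IH _ Hs).
  replace (leval_layer (w ++ l, n, r))
    with (leval w ⊗ leval_layer (l, n, r)).
  + rewrite (interchange (hom_id _) (hom_id _) (leval_layer_typed l n r)
      (ev_typed Hs)).
    now rewrite (comp_hom_id_l (hom_id _)).
  + simpl; now rewrite leval_app, <- tens_id, !tens_assoc.
Qed.

Lemma ev_whisker_r w s a b :
  wf a s b -> ev (a ++ w) (map (whisker_r w) s) = ev a s ⊗ leval w.
Proof.
revert a; induction s as [|[[l n] r] s IH]; intros a.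
- intros ->; simpl; now rewrite leval_app, tens_id.
- intros [-> Hs]; cbn [ev map whisker_r].
  replace (l ++ tgt n ++ r ++ w) with ((l ++ tgt n ++ r) ++ w)
    by now rewrite <- !app_assoc.
  rewrite (IH _ Hs).
  replace (leval_layer (l, n, r ++ w))
    with (leval_layer (l, n, r) ⊗ leval w).
  + rewrite (interchange (leval_layer_typed l n r) (ev_typed Hs)
      (hom_id _) (hom_id _)).
    now rewrite (comp_hom_id_l (hom_id _)).
  + simpl; now rewrite leval_app, <- tens_id, !tens_assoc.
Qed.

Lemma layersP e : well_typed e = true ->
  wf (edom e) (layers e) (ecod e) /\ eval e = ev (edom e) (layers e).
Proof.
induction e as [o|n|g IHg f IHf|f IHf g IHg]; simpl; intros W.
- now rewrite oeval_flat.
- rewrite !app_nil_r; split; [easy|].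
  rewrite tens_unit_l, tens_unit_r.
  symmetry; exact (comp_hom_id_l (arr_typed n)).
- apply andb_prop in W as [[Wg Wf]%andb_prop E%sameP].
  destruct (IHg Wg) as [Hg ->], (IHf Wf) as [Hf ->].
  rewrite <- E in *; split; [exact (wf_app Hf Hg)|].
  symmetry; exact (ev_app Hf Hg).
- apply andb_prop in W as [Wf Wg].
  destruct (IHg Wg) as [Hg ->], (IHf Wf) as [Hf ->].
  pose proof (wf_whisker_r (edom g) Hf) as Hf'.
  pose proof (wf_whisker_l (ecod f) Hg) as Hg'.
  split; [exact (wf_app Hf' Hg')|].
  rewrite (ev_app Hf' Hg'), (ev_whisker_l _ Hg), (ev_whisker_r _ Hf).
  (* A tensor is cut into its left factor followed by its right factor, each whiskered by
     identities. *)
  rewrite (interchange (ev_typed Hf) (hom_id _) (hom_id _) (ev_typed Hg)).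
  now rewrite (comp_hom_id_l (ev_typed Hf)), (comp_hom_id_r (ev_typed Hg)).
Qed.

Lemma swapP x y y' x' s a b :
  swap x y = Some (y', x') -> wf a (x :: y :: s) b ->
  wf a (y' :: x' :: s) b /\ ev a (x :: y :: s) = ev a (y' :: x' :: s).
Proof.
destruct x as [[l1 n1] r1], y as [[l2 n2] r2]; unfold swap.
set (m := skipn _ _); clearbody m.
destruct andb eqn:E; [|easy].
apply andb_prop in E as [->%sameP ->%sameP].
intros [= <- <-] [-> [_ Hs]].
pose proof (ev_typed Hs) as Hev.
pose proof (arr_typed n1) as H1; pose proof (arr_typed n2) as H2.
cbn [wf ev]; rewrite <- ?app_assoc in *; split; [easy|].
cbn [leval_layer].
(* With all tensors left-nested and identities split along the same blocks of wires, [interchange]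
   applies factor by factor. Both orders then reduce to [leval l2 ⊗ arr n2 ⊗ leval m ⊗ arr n1 ⊗
   leval r1]. *)
rewrite ?leval_app, <- ?tens_id, ?tob_assoc, ?tens_assoc in *.
pose proof arr_typed as Q.
erewrite <- hom_comp_assoc, <- hom_comp_assoc;
  try (repeat first [apply hom_tens | apply hom_id | apply Q | exact Hev]).
f_equal.
repeat (erewrite interchange;
  try (repeat first [apply hom_tens | apply hom_id | apply Q])).
repeat erewrite comp_hom_id_l; repeat erewrite comp_hom_id_r;
  try (repeat first [apply hom_tens | apply hom_id | apply Q]).
all: reflexivity.
Qed.

Lemma insertP x s a b : wf a (x :: s) b ->
  wf a (insert x s) b /\ ev a (x :: s) = ev a (insert x s).
Proof.
revert x a; induction s as [|y s IH]; intros x a H; [easy|].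
cbn [insert]; destruct (swap x y) as [[y' x']|] eqn:E; [|easy].
destruct (swapP E H) as [H' ->].
destruct y' as [[l n] r], H' as [-> H'].
destruct (IH _ _ H') as [H'' E'].
split; [easy|]; cbn [ev]; f_equal; exact E'.
Qed.

Lemma passP s a b : wf a s b -> wf a (pass s) b /\ ev a s = ev a (pass s).
Proof.
revert a; induction s as [|[[l n] r] s IH]; intros a; [easy|].
intros [-> H]; destruct (IH _ H) as [H' E].
cbn [pass fold_right].
destruct (insertP (x := (l, n, r)) (conj eq_refl H')) as [H'' E'].
split; [exact H''|]; unfold pass in *; rewrite <- E'; cbn [ev]; now rewrite E.
Qed.

Lemma normalP s a b : wf a s b -> ev a s = ev a (normal s).
Proof.
(* Soundness holds for any number of passes. *)
intros H; unfold normal; generalize (length s) as k.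
assert (I : forall k, wf a (Nat.iter k pass s) b
  /\ ev a s = ev a (Nat.iter k pass s)).
- induction k as [|k [Hk Ek]]; [easy|].
  cbn [Nat.iter nat_rect]; destruct (passP Hk) as [Hp Ep].
  split; [exact Hp|]; etransitivity; [exact Ek|exact Ep].
- apply I.
Qed.

Lemma same_diagramP e f : same_diagram e f = true -> eval e = eval f.
Proof.
unfold same_diagram; destruct list_eq_dec as [N|]; intros H.
- rewrite andb_true_r in H.
  apply andb_prop in H as [[We Wf]%andb_prop D%sameP].
  destruct (layersP We) as [He ->], (layersP Wf) as [Hf ->].
  rewrite (normalP He), (normalP Hf), N, D; reflexivity.
- now rewrite andb_false_r in H.
Qed.

Lemma well_typedP e A B :
  (well_typed e && same (edom e) (flat A) && same (ecod e) (flat B))%bool = true ->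
  hom (oeval A) (oeval B) (eval e).
Proof.
intros H; apply andb_prop in H as [[W EA%sameP]%andb_prop EB%sameP].
destruct (layersP W) as [He ->].
rewrite !oeval_flat, <- EA, <- EB; exact (ev_typed He).
Qed.

End Normalization.

(** * Reification of arrows and the tactics that decide diagrams and typings *)

Lemma hcq_eta_typed (C : ssmcat) (D : hopf_coquasigroup C) : hom K D (eta D).
Proof. exact (eta_typed (hcq_is_monoid (hcq_laws D))). Qed.

Lemma hcq_mu_typed (C : ssmcat) (D : hopf_coquasigroup C) :
  hom (D ⊗ D) D (mu D).
Proof. exact (mu_typed (hcq_is_monoid (hcq_laws D))). Qed.

Lemma hcq_eps_typed (C : ssmcat) (D : hopf_coquasigroup C) : hom D K (eps D).
Proof. exact (eps_typed (hcq_is_comagma (hcq_laws D))). Qed.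

Lemma hcq_delta_typed (C : ssmcat) (D : hopf_coquasigroup C) :
  hom D (D ⊗ D) (delta D).
Proof. exact (delta_typed (hcq_is_comagma (hcq_laws D))). Qed.

(** Structure maps of a Hopf coquasigroup are typed by its laws. Any other generator needs a [hom]
    hypothesis in the context, which is why typings are posed, declared with [Let] or exposed by
    destructing monoid laws in the proofs below. *)
Ltac typing_of f :=
  match f with
  | sym ?A ?B => constr:(sym_hom A B)
  | eta (hcq_monoid (hcq_struct ?D)) => constr:(hcq_eta_typed D)
  | mu (hcq_monoid (hcq_struct ?D)) => constr:(hcq_mu_typed D)
  | eps (hcq_comagma (hcq_struct ?D)) => constr:(hcq_eps_typed D)
  | delta (hcq_comagma (hcq_struct ?D)) => constr:(hcq_delta_typed D)
  | lam (hcq_struct ?D) => constr:(lam_typed (hcq_laws D))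
  | _ => match goal with H : hom _ _ f |- _ => constr:(H) end
  end.

Ltac add x l :=
  let rec go t :=
    match t with
    | nil => constr:(cons x l)
    | cons x _ => l
    | cons _ ?t' => go t'
    end in
  go l.

Ltac position x l :=
  match l with
  | cons x _ => constr:(0)
  | cons _ ?t => let n := position x t in constr:(S n)
  end.

Ltac add_obs A l :=
  match A with
  | K => l
  | tob ?A1 ?A2 => let l1 := add_obs A1 l in add_obs A2 l1
  | _ => add A l
  end.

Ltac reify_ob l A :=
  match A with
  | K => constr:(OUnit)
  | tob ?A1 ?A2 =>
      let o1 := reify_ob l A1 in let o2 := reify_ob l A2 in constr:(OTens o1 o2)
  | _ => let n := position A l in constr:(OAtom n)
  end.

Ltac add_arrs f l :=
  match f with
  | comp ?f1 ?f2 => let l1 := add_arrs f1 l in add_arrs f2 l1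
  | tmor ?f1 ?f2 => let l1 := add_arrs f1 l in add_arrs f2 l1
  | idm _ => l
  | _ => add f l
  end.

(** Identity arrows may mention objects that occur in the type of no generator. *)
Ltac add_ids f l :=
  match f with
  | comp ?f1 ?f2 => let l1 := add_ids f1 l in add_ids f2 l1
  | tmor ?f1 ?f2 => let l1 := add_ids f1 l in add_ids f2 l1
  | idm ?A => add_obs A l
  | _ => l
  end.

Ltac add_arr_obs fs l :=
  match fs with
  | nil => l
  | cons ?f ?fs' =>
      let H := typing_of f in
      match type of H with
      | hom ?A ?B _ =>
          let l1 := add_obs A l in let l2 := add_obs B l1 in add_arr_obs fs' l2
      end
  end.

Ltac arr_types l fs :=
  match fs with
  | nil => constr:(@nil (oexpr * oexpr))
  | cons ?f ?fs' =>
      let H := typing_of f in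
      match type of H with
      | hom ?A ?B _ =>
          let a := reify_ob l A in
          let b := reify_ob l B in
          let t := arr_types l fs' in
          constr:(cons (a, b) t)
      end
  end.

Ltac reify l fs f :=
  match f with
  | comp ?f1 ?f2 =>
      let e1 := reify l fs f1 in let e2 := reify l fs f2 in constr:(EComp e1 e2)
  | tmor ?f1 ?f2 =>
      let e1 := reify l fs f1 in let e2 := reify l fs f2 in constr:(ETens e1 e2)
  | idm ?A => let o := reify_ob l A in constr:(EId o)
  | _ => let n := position f fs in constr:(EGen n)
  end.

Ltac arrs_typed :=
  repeat first
    [ apply Forall2_nil
    | apply Forall2_cons;
      [ match goal with |- hom _ _ ?f => let H := typing_of f in exact H end | ] ].

(* [sym A B] is an uninterpreted generator here: its naturality and the hexagon
   have to be rewritten by hand. *)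
Ltac diag :=
  match goal with
  | |- @eq (mor (ssm_cat ?C)) ?x ?y =>
      let fs := add_arrs x (@nil (mor C)) in
      let fs := add_arrs y fs in
      let l := add_arr_obs fs (@nil (ob C)) in
      let l := add_ids x l in
      let l := add_ids y l in
      let ts := arr_types l fs in
      let e1 := reify l fs x in
      let e2 := reify l fs y in
      refine (@same_diagramP ts C l fs _ e1 e2 _);
      [ arrs_typed | vm_compute; reflexivity ]
  end.

(** Sources and targets are compared after flattening, hence up to strict associativity and
    unitality. *)
Ltac typed :=
  match goal with
  | |- @hom (ssm_cat ?C) ?A ?B ?x =>
      let fs := add_arrs x (@nil (mor C)) in
      let l := add_arr_obs fs (@nil (ob C)) in
      let l := add_ids x l in
      let l := add_obs A l in
      let l := add_obs B l in
      let ts := arr_types l fs in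
      let e := reify l fs x in
      let a := reify_ob l A in
      let b := reify_ob l B in
      refine (@well_typedP ts C l fs _ e a b _);
      [ arrs_typed | vm_compute; reflexivity ]
  end.

(* The recurring pattern of calculation: display a diagram in which one side of the next equation
   occurs literally, then rewrite with that equation. *)
Tactic Notation "via" constr(x) := transitivity x; [diag | ].

(** * The symmetry and tensor products of monoids *)

Section Symmetric.

Variable C : ssmcat.

Lemma sym_natural (A A' B B' : ob C) (f g : mor C) :
  hom A A' f -> hom B B' g -> sym A' B' ∘ (f ⊗ g) = (g ⊗ f) ∘ sym A B.
Proof. intros [<- <-] [<- <-]; apply sym_nat. Qed.

(** The hexagon at [A], [K], [K] makes [sym A K] idempotent, and an invertible idempotent is an
    identity. *)
Lemma sym_unit_r (A : ob C) : sym A K = idm A.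
Proof.
pose proof (sym_hexagon A K K) as H; rewrite tob_unit_l in H.
via (idm A ∘ sym A K).
replace (idm A) with (sym K A ∘ sym A K) at 1
  by now rewrite sym_inv, tob_unit_r.
via (sym K A ∘ (K ⊗ sym A K ∘ (sym A K ⊗ K))).
rewrite <- H, sym_inv; diag.
Qed.

Lemma sym_unit_l (A : ob C) : sym K A = idm A.
Proof.
via (sym K A ∘ idm A).
rewrite <- (sym_unit_r A), sym_inv.
rewrite sym_unit_r; diag.
Qed.

(** The inverse of the given hexagon: inserting [sym E B ∘ sym B E] and [sym E A ∘ sym A E] creates
    the composite [sym E (A ⊗ B)], which cancels against [sym (A ⊗ B) E]. *)
Lemma sym_hexagon_l (A B E : ob C) :
  sym (A ⊗ B)%ob E = (sym A E ⊗ B) ∘ (A ⊗ sym B E).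
Proof.
via (sym (A ⊗ B)%ob E ∘ (A ⊗ (B ⊗ E)%ob)).
rewrite <- (sym_inv B E).
via (sym (A ⊗ B)%ob E ∘ (A ⊗ sym E B) ∘ ((A ⊗ E)%ob ⊗ B) ∘ (A ⊗ sym B E)).
rewrite <- (sym_inv A E).
via (sym (A ⊗ B)%ob E ∘ ((A ⊗ sym E B) ∘ (sym E A ⊗ B)) ∘ (sym A E ⊗ B)
  ∘ (A ⊗ sym B E)).
rewrite <- sym_hexagon, sym_inv; diag.
Qed.

End Symmetric.

Section Monoids.

Variable C : ssmcat.

Lemma monoid_hom_comp (A B E : ob C) (M : monoid_data A) (N : monoid_data B)
    (P : monoid_data E) (f g : mor C) :
  is_monoid M -> is_monoid N -> is_monoid P ->
  monoid_hom M N f -> monoid_hom N P g -> monoid_hom M P (g ∘ f).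
Proof.
intros [] [] [] [Tf fe fm] [Tg ge gm]; split.
- typed.
- via (g ∘ (f ∘ eta M)); now rewrite fe.
- via (g ∘ (f ∘ mu M)); rewrite fm.
  via (g ∘ mu N ∘ (f ⊗ f)); rewrite gm; diag.
Qed.

Lemma monoid_hom_inverse (A B : ob C) (M : monoid_data A) (N : monoid_data B)
    (f g : mor C) :
  is_monoid M -> is_monoid N -> hom B A g -> g ∘ f = A -> f ∘ g = B ->
  monoid_hom M N f -> monoid_hom N M g.
Proof.
intros [] [] Tg gf fg [Tf fe fm]; split; [easy| |].
- rewrite <- fe; via (g ∘ f ∘ eta M); rewrite gf; diag.
- via (g ∘ mu N ∘ (B ⊗ B)); rewrite <- fg.
  via (g ∘ (mu N ∘ (f ⊗ f)) ∘ (g ⊗ g)); rewrite <- fm.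
  via (g ∘ f ∘ mu M ∘ (g ⊗ g)); rewrite gf; diag.
Qed.

Lemma monoid_hom_id (A : ob C) (M : monoid_data A) :
  is_monoid M -> monoid_hom M M A.
Proof. intros []; split; [typed | diag | diag]. Qed.

Lemma tens_is_monoid (A B : ob C) (M : monoid_data A) (N : monoid_data B) :
  is_monoid M -> is_monoid N -> is_monoid (tens_monoid M N).
Proof.
intros [Te Tm ul ur ass] [Te' Tm' ul' ur' ass']; split;
  cbn [eta mu tens_monoid].
- rewrite <- (tob_unit_l K); typed.
- typed.
- via ((mu M ⊗ mu N) ∘ (eta M ⊗ (sym B A ∘ (eta N ⊗ A)) ⊗ B)).
  rewrite (sym_natural Te' (hom_id A)), sym_unit_l.
  via ((mu M ∘ (eta M ⊗ A)) ⊗ (mu N ∘ (eta N ⊗ B))).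
  rewrite ul, ul'; diag.
- via ((mu M ⊗ mu N) ∘ (A ⊗ (sym B A ∘ (B ⊗ eta M)) ⊗ eta N)).
  rewrite (sym_natural (hom_id B) Te), sym_unit_r.
  via ((mu M ∘ (A ⊗ eta M)) ⊗ (mu N ∘ (B ⊗ eta N))).
  rewrite ur, ur'; diag.
(* Associativity: naturality slides [mu N] through the symmetry and the hexagon splits the crossing.
   After reassociating in each factor, the crossings are regrouped and [mu M] slides back. *)
- via ((mu M ⊗ mu N) ∘ (mu M ⊗ (sym B A ∘ (mu N ⊗ A)) ⊗ B)
    ∘ (A ⊗ sym B A ⊗ B ⊗ A ⊗ B)).
  rewrite (sym_natural Tm' (hom_id A)), sym_hexagon_l.
  via ((mu M ∘ (mu M ⊗ A)) ⊗ (mu N ∘ (mu N ⊗ B))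
    ∘ (A ⊗ ((A ⊗ sym B A) ∘ (sym B A ⊗ A)) ⊗ B ⊗ B)
    ∘ (A ⊗ B ⊗ A ⊗ sym B A ⊗ B)).
  rewrite ass, ass'; rewrite <- sym_hexagon.
  via ((mu M ⊗ mu N) ∘ (A ⊗ ((mu M ⊗ B) ∘ sym B (A ⊗ A)%ob) ⊗ mu N)
    ∘ (A ⊗ B ⊗ A ⊗ sym B A ⊗ B)).
  rewrite <- (sym_natural (hom_id B) Tm).
  diag.
Qed.

Lemma tens_monoid_hom (A A' B B' : ob C)
    (M : monoid_data A) (M' : monoid_data A') (N : monoid_data B)
    (N' : monoid_data B') (f g : mor C) :
  is_monoid M -> is_monoid M' -> is_monoid N -> is_monoid N' ->
  monoid_hom M M' f -> monoid_hom N N' g ->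
  monoid_hom (tens_monoid M N) (tens_monoid M' N') (f ⊗ g).
Proof.
intros [] [] [] [] [Tf fe fm] [Tg ge gm]; split; cbn [eta mu tens_monoid].
- typed.
- rewrite <- fe, <- ge; diag.
- via (((f ∘ mu M) ⊗ (g ∘ mu N)) ∘ (A ⊗ sym B A ⊗ B)); rewrite fm, gm.
  via ((mu M' ⊗ mu N') ∘ (f ⊗ ((f ⊗ g) ∘ sym B A) ⊗ g)).
  rewrite <- (sym_natural Tg Tf); diag.
Qed.

Lemma mu_tens_monoid_assoc (A B E : ob C)
    (M : monoid_data A) (N : monoid_data B) (P : monoid_data E) :
  is_monoid M -> is_monoid N -> is_monoid P ->
  mu (tens_monoid (tens_monoid M N) P) = mu (tens_monoid M (tens_monoid N P)).
Proof.
intros [] [] []; cbn [eta mu tens_monoid].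
rewrite sym_hexagon, sym_hexagon_l; diag.
Qed.

(** The two bracketings are equal objects, but the monoid data on them have different types. Being a
    monoid morphism depends only on the underlying arrows and objects, so the change of bracketing
    is made there instead of by transport. *)
Lemma monoid_hom_assoc_cod (A B E F : ob C) (M : monoid_data A)
    (N : monoid_data B) (P : monoid_data E) (Q : monoid_data F) (f : mor C) :
  is_monoid M -> is_monoid N -> is_monoid P ->
  monoid_hom Q (tens_monoid (tens_monoid M N) P) f <->
  monoid_hom Q (tens_monoid M (tens_monoid N P)) f.
Proof.
intros HM HN HP; split; intros [Tf fe fm]; split.
- now rewrite tob_assoc.
- rewrite fe; symmetry; apply tens_assoc.
- now rewrite <- mu_tens_monoid_assoc.
- now rewrite <- tob_assoc.
- rewrite fe; apply tens_assoc.
- now rewrite mu_tens_monoid_assoc.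
Qed.

Lemma monoid_hom_assoc_dom (A B E F : ob C) (M : monoid_data A)
    (N : monoid_data B) (P : monoid_data E) (Q : monoid_data F) (f : mor C) :
  is_monoid M -> is_monoid N -> is_monoid P ->
  monoid_hom (tens_monoid (tens_monoid M N) P) Q f <->
  monoid_hom (tens_monoid M (tens_monoid N P)) Q f.
Proof.
intros HM HN HP; split; intros [Tf fe fm]; split.
- now rewrite tob_assoc.
- rewrite <- fe; cbn [eta tens_monoid]; now rewrite tens_assoc.
- now rewrite <- mu_tens_monoid_assoc.
- now rewrite <- tob_assoc.
- rewrite <- fe; cbn [eta tens_monoid]; now rewrite tens_assoc.
- now rewrite mu_tens_monoid_assoc.
Qed.

Lemma mu_tens_split (A B : ob C) (M : monoid_data A) (N : monoid_data B) :
  is_monoid M -> is_monoid N ->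
  mu (tens_monoid M N) ∘ (A ⊗ eta N ⊗ eta M ⊗ B) = (A ⊗ B)%ob.
Proof.
intros [Te Tm ul ur _] [Te' Tm' ul' ur' _]; cbn [eta mu tens_monoid].
via ((mu M ⊗ mu N) ∘ (A ⊗ (sym B A ∘ (eta N ⊗ eta M)) ⊗ B)).
rewrite (sym_natural Te' Te), sym_unit_r.
via ((mu M ∘ (A ⊗ eta M)) ⊗ (mu N ∘ (eta N ⊗ B))).
rewrite ur, ul'; diag.
Qed.

(** Multiplying the two unit inclusions in the opposite order produces the symmetry. This is the
    source of the condition [cm_comm]. *)
Lemma mu_tens_sym (A B : ob C) (M : monoid_data A) (N : monoid_data B) :
  is_monoid M -> is_monoid N ->
  mu (tens_monoid M N) ∘ (eta M ⊗ B ⊗ A ⊗ eta N) = sym B A.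
Proof.
intros [Te Tm ul ur _] [Te' Tm' ul' ur' _]; cbn [eta mu tens_monoid].
via (((mu M ∘ (eta M ⊗ A)) ⊗ (mu N ∘ (B ⊗ eta N))) ∘ sym B A).
rewrite ul, ur'; diag.
Qed.

(** A pure tensor is the product of its two parts, by [mu_tens_split], and [f] is multiplicative. *)
Lemma monoid_hom_tens_decomp (A B E : ob C) (M : monoid_data A)
    (N : monoid_data B) (P : monoid_data E) (f : mor C) :
  is_monoid M -> is_monoid N -> is_monoid P -> monoid_hom (tens_monoid M N) P f ->
  f = mu P ∘ ((f ∘ (A ⊗ eta N)) ⊗ (f ∘ (eta M ⊗ B))).
Proof.
intros HM HN HP [Tf _ fm]; pose proof (mu_typed (tens_is_monoid HM HN)).
pose proof (mu_tens_split HM HN) as Hsplit; destruct HM, HN, HP.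
via (f ∘ (A ⊗ B)%ob); rewrite <- Hsplit.
via (f ∘ mu (tens_monoid M N) ∘ (A ⊗ eta N ⊗ eta M ⊗ B)).
rewrite fm; diag.
Qed.

Lemma monoid_hom_tens_ext (A B E : ob C) (M : monoid_data A)
    (N : monoid_data B) (P : monoid_data E) (f g : mor C) :
  is_monoid M -> is_monoid N -> is_monoid P ->
  monoid_hom (tens_monoid M N) P f -> monoid_hom (tens_monoid M N) P g ->
  f ∘ (A ⊗ eta N) = g ∘ (A ⊗ eta N) -> f ∘ (eta M ⊗ B) = g ∘ (eta M ⊗ B) ->
  f = g.
Proof.
intros HM HN HP Hf Hg EA EB.
rewrite (monoid_hom_tens_decomp HM HN HP Hf), EA, EB.
symmetry; exact (monoid_hom_tens_decomp HM HN HP Hg).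
Qed.

(** Converse of the decomposition: the images of [f] and [g] commute, so the two middle factors of
    [f(a1) g(b1) f(a2) g(b2)] can be exchanged. The rest is reassociation around that exchange. *)
Lemma commuting_monoid_homs (A B E : ob C) (M : monoid_data A)
    (N : monoid_data B) (P : monoid_data E) (f g : mor C) :
  is_monoid M -> is_monoid N -> is_monoid P ->
  monoid_hom M P f -> monoid_hom N P g ->
  mu P ∘ (g ⊗ f) = mu P ∘ (f ⊗ g) ∘ sym B A ->
  monoid_hom (tens_monoid M N) P (mu P ∘ (f ⊗ g)).
Proof.
intros [] [] [TeP TmP ul ur ass] [Tf fe fm] [Tg ge gm] comm; split;
  cbn [eta mu tens_monoid].
- typed.
- via (mu P ∘ ((f ∘ eta M) ⊗ (g ∘ eta N))); rewrite fe, ge.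
  via (mu P ∘ (eta P ⊗ E) ∘ eta P); rewrite ul; diag.
- via (mu P ∘ ((f ∘ mu M) ⊗ (g ∘ mu N)) ∘ (A ⊗ sym B A ⊗ B)).
  rewrite fm, gm.
  via (mu P ∘ (E ⊗ mu P) ∘ (mu P ⊗ E ⊗ E) ∘ (f ⊗ f ⊗ g ⊗ g)
    ∘ (A ⊗ sym B A ⊗ B)).
  rewrite <- ass.
  via (mu P ∘ ((mu P ∘ (mu P ⊗ E)) ⊗ E) ∘ (f ⊗ f ⊗ g ⊗ g)
    ∘ (A ⊗ sym B A ⊗ B)).
  rewrite ass.
  via (mu P ∘ (mu P ⊗ E) ∘ (f ⊗ (mu P ∘ (f ⊗ g) ∘ sym B A) ⊗ g)).
  rewrite <- comm.
  via (mu P ∘ ((mu P ∘ (E ⊗ mu P)) ⊗ E) ∘ (f ⊗ g ⊗ f ⊗ g)).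
  rewrite <- ass.
  via (mu P ∘ (mu P ⊗ E) ∘ (mu P ⊗ E ⊗ E) ∘ (f ⊗ g ⊗ f ⊗ g)).
  rewrite ass; diag.
Qed.

End Monoids.
(** * Hopf coquasigroups *)

Section HopfCoquasigroups.

Variable C : ssmcat.

Lemma iso_inverse (A B : ob C) (f : mor C) :
  hom A B f -> is_iso f ->
  exists g, hom B A g /\ g ∘ f = A /\ f ∘ g = B.
Proof. now intros [<- <-] [g Hg]; exists g. Qed.

Lemma cancel_retraction (X A B : ob C) (s t h k : mor C) :
  hom A B s -> hom B A t -> t ∘ s = A -> hom X A h -> hom X A k ->
  s ∘ h = s ∘ k -> h = k.
Proof.
intros Ts Tt ts Th Tk E; via (A ∘ h); rewrite <- ts.
via (t ∘ (s ∘ h)); rewrite E; via (t ∘ s ∘ k); rewrite ts; diag.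
Qed.

Lemma cancel_section (X A B : ob C) (s t h k : mor C) :
  hom A B s -> hom B A t -> s ∘ t = B -> hom B X h -> hom B X k ->
  h ∘ s = k ∘ s -> h = k.
Proof.
intros Ts Tt st Th Tk E; via (h ∘ B); rewrite <- st.
via (h ∘ s ∘ t); rewrite E; via (k ∘ (s ∘ t)); rewrite st; diag.
Qed.

Lemma section_epi (A B : ob C) (s t : mor C) :
  hom A B s -> hom B A t -> s ∘ t = B -> is_epi s.
Proof.
intros Ts Tt st h k Hh Hk Hhk E.
rewrite (proj2 Ts) in Hh, Hk.
exact (@cancel_section (cod k) A B s t h k Ts Tt st
  (conj Hh Hhk) (conj Hk eq_refl) E).
Qed.

Lemma eps_eta (D : hopf_coquasigroup C) : eps D ∘ eta D = idm K.
Proof. exact (comagma_hom_eps (hcq_eta_hom (hcq_laws D))). Qed.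

Lemma eps_mu (D : hopf_coquasigroup C) : eps D ∘ mu D = eps D ⊗ eps D.
Proof. exact (comagma_hom_eps (hcq_mu_hom (hcq_laws D))). Qed.

Lemma delta_eta (D : hopf_coquasigroup C) : delta D ∘ eta D = eta D ⊗ eta D.
Proof.
rewrite (comagma_hom_delta (hcq_eta_hom (hcq_laws D))).
cbn [delta unit_comagma]; diag.
Qed.

Lemma counit_l (D : hopf_coquasigroup C) : (eps D ⊗ D) ∘ delta D = D.
Proof. exact (delta_counit_l (hcq_is_comagma (hcq_laws D))). Qed.

Lemma counit_r (D : hopf_coquasigroup C) : (D ⊗ eps D) ∘ delta D = D.
Proof. exact (delta_counit_r (hcq_is_comagma (hcq_laws D))). Qed.

Lemma delta_monoid_hom (D : hopf_coquasigroup C) :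
  monoid_hom D (tens_monoid D D) (delta D).
Proof.
split; [typed | exact (delta_eta D) |].
rewrite (comagma_hom_delta (hcq_mu_hom (hcq_laws D))).
cbn [delta mu tens_comagma tens_monoid]; diag.
Qed.

(** The usual antipode identity is the axiom [antipode_r1] with the counit applied to its first
    leg. *)
Lemma antipode_convolution_r (D : hopf_coquasigroup C) :
  mu D ∘ (D ⊗ lam D) ∘ delta D = eta D ∘ eps D.
Proof.
rewrite <- (counit_l D) at 1.
via ((eps D ⊗ D) ∘ ((D ⊗ mu D) ∘ (delta D ⊗ lam D) ∘ delta D)).
rewrite (antipode_r1 (hcq_laws D)); diag.
Qed.

(* Both sides are the two evaluations of the product of [f (lam y1)],
   [f y2] and [lam (f y3)]. *)
Lemma hcq_hom_lam (D E : hopf_coquasigroup C) (f : mor C) :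
  hcq_hom D E f -> f ∘ lam D = lam E ∘ f.
Proof.
intros [[Tf fe fm] [_ feps fd]].
destruct (hcq_is_monoid (hcq_laws E)) as [_ _ ul ur ass].
via (f ∘ lam D ∘ D); rewrite <- (counit_r D).
via ((E ⊗ eps D) ∘ ((f ∘ lam D) ⊗ D) ∘ delta D); rewrite <- feps.
via (E ∘ ((f ∘ lam D) ⊗ (eps E ∘ f)) ∘ delta D); rewrite <- ur.
via (mu E ∘ ((f ∘ lam D) ⊗ (eta E ∘ eps E ∘ f)) ∘ delta D).
rewrite <- antipode_convolution_r.
via (mu E ∘ ((f ∘ lam D) ⊗ (mu E ∘ (E ⊗ lam E) ∘ (delta E ∘ f))) ∘ delta D).
rewrite fd.
via (mu E ∘ (E ⊗ mu E) ∘ ((f ∘ lam D) ⊗ f ⊗ (lam E ∘ f)) ∘ (D ⊗ delta D)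
  ∘ delta D).
rewrite <- ass.
via (mu E ∘ ((mu E ∘ (f ⊗ f)) ⊗ (lam E ∘ f)) ∘ (lam D ⊗ delta D) ∘ delta D).
rewrite <- fm.
via (mu E ∘ (f ⊗ (lam E ∘ f)) ∘ ((mu D ⊗ D) ∘ (lam D ⊗ delta D) ∘ delta D)).
rewrite (antipode_l1 (hcq_laws D)).
via (mu E ∘ ((f ∘ eta D) ⊗ E) ∘ lam E ∘ f); rewrite fe, ul; diag.
Qed.

Lemma unit_l_monoid_hom (A B : ob C) (M : monoid_data A) (N : monoid_data B) :
  is_monoid M -> is_monoid N -> monoid_hom N (tens_monoid M N) (eta M ⊗ B).
Proof.
intros [Te Tm ul _ _] [Te' Tm' _ _ _]; split; cbn [eta mu tens_monoid].
- rewrite <- (tob_unit_l B) at 1; typed.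
- diag.
- symmetry; via ((mu M ⊗ mu N) ∘ (eta M ⊗ (sym B A ∘ (B ⊗ eta M)) ⊗ B)).
  rewrite (sym_natural (hom_id B) Te), sym_unit_r.
  via (((mu M ∘ (eta M ⊗ A) ∘ eta M) ⊗ mu N)); rewrite ul; diag.
Qed.

Lemma unit_r_monoid_hom (A B : ob C) (M : monoid_data A) (N : monoid_data B) :
  is_monoid M -> is_monoid N -> monoid_hom M (tens_monoid M N) (A ⊗ eta N).
Proof.
intros [Te Tm _ _ _] [Te' Tm' ul _ _]; split; cbn [eta mu tens_monoid].
- rewrite <- (tob_unit_r A) at 1; typed.
- diag.
- symmetry; via ((mu M ⊗ mu N) ∘ (A ⊗ (sym B A ∘ (eta N ⊗ A)) ⊗ eta N)).
  rewrite (sym_natural Te' (hom_id A)), sym_unit_l.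
  via ((mu M ⊗ (mu N ∘ (eta N ⊗ B) ∘ eta N))); rewrite ul; diag.
Qed.

Lemma counit_r_monoid_hom (A : ob C) (M : monoid_data A)
    (B : hopf_coquasigroup C) :
  is_monoid M -> monoid_hom (tens_monoid M B) M (A ⊗ eps B).
Proof.
intros [Te Tm _ _ _]; split; cbn [eta mu tens_monoid].
- rewrite <- (tob_unit_r A) at 2; typed.
- via (eta M ⊗ (eps B ∘ eta B)); rewrite eps_eta; diag.
- via ((mu M ⊗ (eps B ∘ mu B)) ∘ (A ⊗ sym B A ⊗ B)); rewrite eps_mu.
  via ((mu M ⊗ eps B) ∘ (A ⊗ ((A ⊗ eps B) ∘ sym B A) ⊗ B)).
  rewrite <- (sym_natural (hcq_eps_typed B) (hom_id A)), sym_unit_l; diag.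
Qed.

Lemma counit_l_monoid_hom (A : hopf_coquasigroup C) (B : ob C)
    (N : monoid_data B) :
  is_monoid N -> monoid_hom (tens_monoid A N) N (eps A ⊗ B).
Proof.
intros [Te Tm _ _ _]; split; cbn [eta mu tens_monoid].
- rewrite <- (tob_unit_l B) at 2; typed.
- via ((eps A ∘ eta A) ⊗ eta N); rewrite eps_eta; diag.
- via (((eps A ∘ mu A) ⊗ mu N) ∘ (A ⊗ sym B A ⊗ B)); rewrite eps_mu.
  via ((eps A ⊗ mu N) ∘ (A ⊗ ((eps A ⊗ B) ∘ sym B A) ⊗ B)).
  rewrite <- (sym_natural (hom_id B) (hcq_eps_typed A)), sym_unit_r; diag.
Qed.

Lemma comagma_hom_inverse (A B : ob C) (M : comagma_data A)
    (N : comagma_data B) (f g : mor C) :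
  hom A (A ⊗ A) (delta M) -> hom B (B ⊗ B) (delta N) -> hom B K (eps N) ->
  hom B A g -> g ∘ f = A -> f ∘ g = B ->
  comagma_hom M N f -> comagma_hom N M g.
Proof.
intros TM TN Te Tg gf fg [Tf fe fd]; split; [easy| |].
- rewrite <- fe; via (eps N ∘ (f ∘ g)); rewrite fg; diag.
- via ((A ⊗ A) ∘ delta M ∘ g); rewrite <- gf.
  via ((g ⊗ g) ∘ ((f ⊗ f) ∘ delta M) ∘ g); rewrite <- fd.
  via ((g ⊗ g) ∘ delta N ∘ (f ∘ g)); rewrite fg; diag.
Qed.

End HopfCoquasigroups.
(** * From cofactorizations to comatched pairs *)

Section Forward.

Variables (C : ssmcat) (Y D B : hopf_coquasigroup C).
Variables (pD pB w lD lB Om : mor C).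
Hypothesis fact : is_cofactorization Y D B pD pB.

Local Notation u := ((pD ⊗ pB) ∘ delta Y).
Local Notation v := ((pB ⊗ pD) ∘ delta Y).

Hypotheses (Tw : hom (D ⊗ B) Y w) (wu : w ∘ u = Y) (uw : u ∘ w = (D ⊗ B)%ob).
Hypotheses (TlD : hom D D lD) (lDK : lD ∘ lam D = D).
Hypotheses (TlB : hom B B lB) (lBK : lB ∘ lam B = B).
(** A variable with an equation, rather than the composite itself, so that [diag] treats [Om] as one
    generator. *)
Hypothesis OmE : Om = v ∘ w.

Local Notation rho := (Om ∘ (eta D ⊗ B)).
Local Notation r := (Om ∘ (D ⊗ eta B)).

Let TD : hom Y D pD.
Proof. exact (monoid_hom_typed (proj1 (cofact_pD_hom fact))). Qed.

Let TB : hom Y B pB.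
Proof. exact (monoid_hom_typed (proj1 (cofact_pB_hom fact))). Qed.

Let TOm : hom (D ⊗ B) (B ⊗ D) Om.
Proof. rewrite OmE; typed. Qed.

Let deltaD : delta D ∘ pD = (pD ⊗ pD) ∘ delta Y.
Proof. exact (comagma_hom_delta (proj2 (cofact_pD_hom fact))). Qed.

Let deltaB : delta B ∘ pB = (pB ⊗ pB) ∘ delta Y.
Proof. exact (comagma_hom_delta (proj2 (cofact_pB_hom fact))). Qed.

Let epsD : eps D ∘ pD = eps Y.
Proof. exact (comagma_hom_eps (proj2 (cofact_pD_hom fact))). Qed.

Let epsB : eps B ∘ pB = eps Y.
Proof. exact (comagma_hom_eps (proj2 (cofact_pB_hom fact))). Qed.

Lemma cancel_u (X : ob C) (g h : mor C) :
  hom (D ⊗ B) X g -> hom (D ⊗ B) X h -> g ∘ u = h ∘ u -> g = h.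
Proof.
intros Tg Th; refine (cancel_section (A := Y) _ Tw uw Tg Th); typed.
Qed.

Lemma Om_u : Om ∘ u = v.
Proof. rewrite OmE; via (v ∘ (w ∘ u)); rewrite wu; diag. Qed.

Lemma cofact_1_lr : (Y ⊗ u) ∘ delta Y = (((Y ⊗ pD) ∘ delta Y) ⊗ pB) ∘ delta Y.
Proof. exact (cofact_1 fact). Qed.

Lemma cofact_2_lr : (u ⊗ Y) ∘ delta Y = (pD ⊗ ((pB ⊗ Y) ∘ delta Y)) ∘ delta Y.
Proof. exact (cofact_2 fact). Qed.

(** Composing the axiom with the left inverses [lB] and [lD] strips the antipodes. What remains is a
    coassociativity of [Y] seen through [pB] and [pD]. *)
Lemma cofact_3_lr : (Y ⊗ v) ∘ delta Y = (((Y ⊗ pB) ∘ delta Y) ⊗ pD) ∘ delta Y.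
Proof.
pose proof (cofact_3 fact) as E; unfold cofact_v in E.
via ((Y ⊗ (B ⊗ D)) ∘ (Y ⊗ v) ∘ delta Y); rewrite <- lBK, <- lDK.
via ((Y ⊗ (lB ⊗ lD)) ∘ ((Y ⊗ ((lam B ⊗ lam D) ∘ v)) ∘ delta Y)); rewrite E.
via ((((Y ⊗ (lB ∘ lam B ∘ pB)) ∘ delta Y) ⊗ (lD ∘ lam D ∘ pD)) ∘ delta Y).
rewrite lBK, lDK; diag.
Qed.

Lemma cofact_4_lr : (v ⊗ Y) ∘ delta Y = (pB ⊗ ((pD ⊗ Y) ∘ delta Y)) ∘ delta Y.
Proof.
pose proof (cofact_4 fact) as E; unfold cofact_v in E.
via (((B ⊗ D) ⊗ Y) ∘ (v ⊗ Y) ∘ delta Y); rewrite <- lBK, <- lDK.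
via (((lB ⊗ lD) ⊗ Y) ∘ ((((lam B ⊗ lam D) ∘ v) ⊗ Y) ∘ delta Y)); rewrite E.
via (((lB ∘ lam B ∘ pB) ⊗ (((lD ∘ lam D ∘ pD) ⊗ Y) ∘ delta Y)) ∘ delta Y).
rewrite lBK, lDK; diag.
Qed.

(** [ThD] and [ThB] are [(Y ⊗ pD) ∘ delta Y] and [(pB ⊗ Y) ∘ delta Y] carried along [u] to the
    object [D ⊗ B], as [u_pD_delta] and [pB_u_delta] show. *)
Local Notation ThD := ((D ⊗ Om) ∘ (delta D ⊗ B)).
Local Notation ThB := ((Om ⊗ B) ∘ (D ⊗ delta B)).

Lemma u_pD_delta : (u ⊗ pD) ∘ delta Y = ThD ∘ u.
Proof.
via ((D ⊗ B ⊗ pD) ∘ ((u ⊗ Y) ∘ delta Y)); rewrite cofact_2_lr.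
via ((pD ⊗ v) ∘ delta Y); rewrite <- Om_u.
via ((pD ⊗ Om) ∘ ((Y ⊗ u) ∘ delta Y)); rewrite cofact_1_lr.
via ((D ⊗ Om) ∘ (((pD ⊗ pD) ∘ delta Y) ⊗ pB) ∘ delta Y); rewrite <- deltaD.
diag.
Qed.

Lemma u_pB_delta : (u ⊗ pB) ∘ delta Y = (D ⊗ delta B) ∘ u.
Proof.
via ((D ⊗ B ⊗ pB) ∘ ((u ⊗ Y) ∘ delta Y)); rewrite cofact_2_lr.
via ((pD ⊗ ((pB ⊗ pB) ∘ delta Y)) ∘ delta Y); rewrite <- deltaB; diag.
Qed.

Lemma pB_u_delta : (pB ⊗ u) ∘ delta Y = ThB ∘ u.
Proof.
via ((pB ⊗ D ⊗ B) ∘ ((Y ⊗ u) ∘ delta Y)); rewrite cofact_1_lr.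
via ((v ⊗ pB) ∘ delta Y); rewrite <- Om_u.
via ((Om ⊗ B) ∘ ((u ⊗ pB) ∘ delta Y)); rewrite u_pB_delta; diag.
Qed.

Lemma delta_B_Om : (delta B ⊗ D) ∘ Om = (B ⊗ Om) ∘ (Om ⊗ B) ∘ (D ⊗ delta B).
Proof.
apply (@cancel_u (B ⊗ B ⊗ D)%ob); [typed | typed |].
via ((delta B ⊗ D) ∘ (Om ∘ u)); rewrite Om_u.
via (((delta B ∘ pB) ⊗ pD) ∘ delta Y); rewrite deltaB.
via ((pB ⊗ B ⊗ D) ∘ ((((Y ⊗ pB) ∘ delta Y) ⊗ pD) ∘ delta Y)).
rewrite <- cofact_3_lr.
via ((pB ⊗ v) ∘ delta Y); rewrite <- Om_u.
via ((B ⊗ Om) ∘ ((pB ⊗ u) ∘ delta Y)); rewrite pB_u_delta; diag.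
Qed.

Lemma delta_D_Om : (B ⊗ delta D) ∘ Om = (Om ⊗ D) ∘ (D ⊗ Om) ∘ (delta D ⊗ B).
Proof.
apply (@cancel_u (B ⊗ D ⊗ D)%ob); [typed | typed |].
via ((B ⊗ delta D) ∘ (Om ∘ u)); rewrite Om_u.
via ((pB ⊗ (delta D ∘ pD)) ∘ delta Y); rewrite deltaD.
via ((B ⊗ D ⊗ pD) ∘ ((pB ⊗ ((pD ⊗ Y) ∘ delta Y)) ∘ delta Y)).
rewrite <- cofact_4_lr.
via ((v ⊗ pD) ∘ delta Y); rewrite <- Om_u.
via ((Om ⊗ D) ∘ ((u ⊗ pD) ∘ delta Y)); rewrite u_pD_delta; diag.
Qed.

(** Precomposed with [u], both sides become [pB], since the counits of [D] and [Y] agree along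
    [pD]. *)
Lemma Om_eps_D : (B ⊗ eps D) ∘ Om = eps D ⊗ B.
Proof.
apply (@cancel_u B); [rewrite <- (tob_unit_r B) at 2; typed
  | rewrite <- (tob_unit_l B) at 2; typed |].
via ((B ⊗ eps D) ∘ (Om ∘ u)); rewrite Om_u.
via ((pB ⊗ (eps D ∘ pD)) ∘ delta Y); rewrite epsD.
via (pB ∘ ((Y ⊗ eps Y) ∘ delta Y)); rewrite counit_r, <- (counit_l Y), <- epsD.
diag.
Qed.

Lemma Om_eps_B : (eps B ⊗ D) ∘ Om = D ⊗ eps B.
Proof.
apply (@cancel_u D); [rewrite <- (tob_unit_l D) at 2; typed
  | rewrite <- (tob_unit_r D) at 2; typed |].
via ((eps B ⊗ D) ∘ (Om ∘ u)); rewrite Om_u.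
via (((eps B ∘ pB) ⊗ pD) ∘ delta Y); rewrite epsB.
via (pD ∘ ((eps Y ⊗ Y) ∘ delta Y)); rewrite counit_l, <- (counit_r Y), <- epsB.
diag.
Qed.

(** * Multiplicativity of [Om] and the coactions [rho] and [r] *)

Let MD := hcq_is_monoid (hcq_laws D).
Let MB := hcq_is_monoid (hcq_laws B).
Let MY := hcq_is_monoid (hcq_laws Y).

Lemma u_monoid_hom : monoid_hom Y (tens_monoid D B) u.
Proof.
exact (monoid_hom_comp MY (tens_is_monoid MY MY) (tens_is_monoid MD MB)
  (delta_monoid_hom Y)
  (tens_monoid_hom MY MD MY MB
    (proj1 (cofact_pD_hom fact)) (proj1 (cofact_pB_hom fact)))).
Qed.

Lemma Om_monoid_hom : monoid_hom (tens_monoid D B) (tens_monoid B D) Om.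
Proof.
rewrite OmE.
refine (monoid_hom_comp (tens_is_monoid MD MB) MY (tens_is_monoid MB MD) _ _).
- exact (monoid_hom_inverse MY (tens_is_monoid MD MB) Tw wu uw u_monoid_hom).
- exact (monoid_hom_comp MY (tens_is_monoid MY MY) (tens_is_monoid MB MD)
    (delta_monoid_hom Y)
    (tens_monoid_hom MY MB MY MD
      (proj1 (cofact_pB_hom fact)) (proj1 (cofact_pD_hom fact)))).
Qed.

Lemma Omega_Om : Omega B D rho r = Om.
Proof.
symmetry; exact (monoid_hom_tens_decomp MD MB (tens_is_monoid MB MD)
  Om_monoid_hom).
Qed.

Lemma rho_monoid_hom : monoid_hom B (tens_monoid B D) rho.
Proof.
exact (monoid_hom_comp MB (tens_is_monoid MD MB) (tens_is_monoid MB MD)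
  (unit_l_monoid_hom MD MB) Om_monoid_hom).
Qed.

Lemma r_monoid_hom : monoid_hom D (tens_monoid B D) r.
Proof.
exact (monoid_hom_comp MD (tens_is_monoid MD MB) (tens_is_monoid MB MD)
  (unit_r_monoid_hom MD MB) Om_monoid_hom).
Qed.

Lemma rho_comodule_monoid : is_right_comodule_monoid D B rho.
Proof.
destruct rho_monoid_hom as [Trho He Hm]; split; [easy | | | exact He |].
- via ((B ⊗ eps D) ∘ Om ∘ (eta D ⊗ B)); rewrite Om_eps_D.
  via ((eps D ∘ eta D) ⊗ B); rewrite eps_eta; diag.
- via ((Om ⊗ D) ∘ (D ⊗ Om) ∘ (eta D ⊗ eta D ⊗ B)); rewrite <- delta_eta.
  via ((Om ⊗ D) ∘ (D ⊗ Om) ∘ (delta D ⊗ B) ∘ (eta D ⊗ B)).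
  rewrite <- delta_D_Om; diag.
- rewrite Hm; cbn [mu tens_monoid]; diag.
Qed.

Lemma r_comodule_monoid : is_left_comodule_monoid B D r.
Proof.
destruct r_monoid_hom as [Tr He Hm]; split; [easy | | | exact He | exact Hm].
- via ((eps B ⊗ D) ∘ Om ∘ (D ⊗ eta B)); rewrite Om_eps_B.
  via (D ⊗ (eps B ∘ eta B)); rewrite eps_eta; diag.
- via ((B ⊗ Om) ∘ (Om ⊗ B) ∘ (D ⊗ (eta B ⊗ eta B))); rewrite <- delta_eta.
  via ((B ⊗ Om) ∘ (Om ⊗ B) ∘ (D ⊗ delta B) ∘ (D ⊗ eta B)).
  rewrite <- delta_B_Om; diag.
Qed.

(** Applying [ThD] twice is splitting [Y] twice on the left, so an antipode axiom of [Y] passes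
    through [u]. The parameter [q] stands for [mu Y ∘ (Y ⊗ lam Y)] or [mu Y ∘ (lam Y ⊗ Y)], which
    treats both axioms at once. *)
Lemma Om_antipode_D (q q' : mor C) :
  hom (Y ⊗ Y) Y q -> hom (D ⊗ D) D q' -> pD ∘ q = q' ∘ (pD ⊗ pD) ->
  (Y ⊗ q) ∘ (delta Y ⊗ Y) ∘ delta Y = Y ⊗ eta Y ->
  (D ⊗ B ⊗ q') ∘ (ThD ⊗ D) ∘ ThD = D ⊗ B ⊗ eta D.
Proof.
intros Tq Tq' Hq E.
apply (@cancel_u (D ⊗ B ⊗ D)%ob); [typed
  | rewrite <- (tob_unit_r (D ⊗ B)%ob) at 1; typed |].
via ((D ⊗ B ⊗ q') ∘ (ThD ⊗ D) ∘ (ThD ∘ u)); rewrite <- u_pD_delta.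
via ((D ⊗ B ⊗ q') ∘ ((ThD ∘ u) ⊗ pD) ∘ delta Y); rewrite <- u_pD_delta.
via ((u ⊗ (q' ∘ (pD ⊗ pD))) ∘ (delta Y ⊗ Y) ∘ delta Y); rewrite <- Hq.
via ((u ⊗ pD) ∘ ((Y ⊗ q) ∘ (delta Y ⊗ Y) ∘ delta Y)); rewrite E.
via (u ⊗ (pD ∘ eta Y)).
rewrite (monoid_hom_eta (proj1 (cofact_pD_hom fact))); diag.
Qed.

Lemma Om_antipode_B (q q' : mor C) :
  hom (Y ⊗ Y) Y q -> hom (B ⊗ B) B q' -> pB ∘ q = q' ∘ (pB ⊗ pB) ->
  (q ⊗ Y) ∘ (Y ⊗ delta Y) ∘ delta Y = eta Y ⊗ Y ->
  (q' ⊗ D ⊗ B) ∘ (B ⊗ ThB) ∘ ThB = eta B ⊗ D ⊗ B.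
Proof.
intros Tq Tq' Hq E.
apply (@cancel_u (B ⊗ D ⊗ B)%ob); [typed
  | rewrite <- (tob_unit_l (D ⊗ B)%ob), <- tob_assoc at 1; typed |].
via ((q' ⊗ D ⊗ B) ∘ (B ⊗ ThB) ∘ (ThB ∘ u)); rewrite <- pB_u_delta.
via ((q' ⊗ D ⊗ B) ∘ (pB ⊗ (ThB ∘ u)) ∘ delta Y); rewrite <- pB_u_delta.
via (((q' ∘ (pB ⊗ pB)) ⊗ u) ∘ (Y ⊗ delta Y) ∘ delta Y); rewrite <- Hq.
via ((pB ⊗ u) ∘ ((q ⊗ Y) ∘ (Y ⊗ delta Y) ∘ delta Y)); rewrite E.
via ((pB ∘ eta Y) ⊗ u).
rewrite (monoid_hom_eta (proj1 (cofact_pB_hom fact))); diag.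
Qed.

Lemma comatched : is_comatched_pair B D rho r.
Proof.
destruct (cofact_pD_hom fact) as [[_ _ muD] _].
destruct (cofact_pB_hom fact) as [[_ _ muB] _].
pose proof (hcq_hom_lam (cofact_pD_hom fact)) as lamD.
pose proof (hcq_hom_lam (cofact_pB_hom fact)) as lamB.
split; try rewrite Omega_Om.
- exact rho_comodule_monoid.
- exact r_comodule_monoid.
- via ((eps B ⊗ D) ∘ Om ∘ (eta D ⊗ B)); rewrite Om_eps_B; diag.
- via ((B ⊗ eps D) ∘ Om ∘ (D ⊗ eta B)); rewrite Om_eps_D; diag.
- destruct Om_monoid_hom as [_ _ Hm].
  pose proof (mu_typed (tens_is_monoid MB MD)).
  pose proof (mu_typed (tens_is_monoid MD MB)).
  (* The product of [rho] and [r] in this order is [Om] of the product of the unit inclusions taken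
     in the opposite order, that is, of the symmetry. *)
  via (mu (tens_monoid B D) ∘ (Om ⊗ Om) ∘ (eta D ⊗ B ⊗ D ⊗ eta B)).
  rewrite <- Hm.
  via (Om ∘ (mu (tens_monoid D B) ∘ (eta D ⊗ B ⊗ D ⊗ eta B))).
  rewrite (mu_tens_sym MD MB); diag.
- via ((B ⊗ lam B ⊗ lam D) ∘ ((delta B ⊗ D) ∘ Om) ∘ (eta D ⊗ B)).
  rewrite delta_B_Om; diag.
(* On the unit of [B], the inner [Om] becomes [r] and the outer one remains: the conditions of the
   pair are [Om_antipode_D] restricted to [D] and, below, [Om_antipode_B] restricted to [B]. *)
- via ((D ⊗ B ⊗ (mu D ∘ (D ⊗ lam D))) ∘ (ThD ⊗ D) ∘ ThD ∘ (D ⊗ eta B)).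
  rewrite (@Om_antipode_D (mu Y ∘ (Y ⊗ lam Y))); [diag | typed | typed | |].
  + via (pD ∘ mu Y ∘ (Y ⊗ lam Y)); rewrite muD.
    via (mu D ∘ (pD ⊗ (pD ∘ lam Y))); rewrite lamD; diag.
  + rewrite <- (antipode_r1 (hcq_laws Y)); diag.
- via ((D ⊗ B ⊗ (mu D ∘ (lam D ⊗ D))) ∘ (ThD ⊗ D) ∘ ThD ∘ (D ⊗ eta B)).
  rewrite (@Om_antipode_D (mu Y ∘ (lam Y ⊗ Y))); [diag | typed | typed | |].
  + via (pD ∘ mu Y ∘ (lam Y ⊗ Y)); rewrite muD.
    via (mu D ∘ ((pD ∘ lam Y) ⊗ pD)); rewrite lamD; diag.
  + rewrite <- (antipode_r2 (hcq_laws Y)); diag.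
- via ((lam B ⊗ lam D ⊗ D) ∘ ((B ⊗ delta D) ∘ Om) ∘ (D ⊗ eta B)).
  rewrite delta_D_Om; diag.
- via (((mu B ∘ (lam B ⊗ B)) ⊗ D ⊗ B) ∘ (B ⊗ ThB) ∘ ThB ∘ (eta D ⊗ B)).
  rewrite (@Om_antipode_B (mu Y ∘ (lam Y ⊗ Y))); [diag | typed | typed | |].
  + via (pB ∘ mu Y ∘ (lam Y ⊗ Y)); rewrite muB.
    via (mu B ∘ ((pB ∘ lam Y) ⊗ pB)); rewrite lamB; diag.
  + rewrite <- (antipode_l1 (hcq_laws Y)); diag.
- via (((mu B ∘ (B ⊗ lam B)) ⊗ D ⊗ B) ∘ (B ⊗ ThB) ∘ ThB ∘ (eta D ⊗ B)).
  rewrite (@Om_antipode_B (mu Y ∘ (Y ⊗ lam Y))); [diag | typed | typed | |].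
  + via (pB ∘ mu Y ∘ (Y ⊗ lam Y)); rewrite muB.
    via (mu B ∘ (pB ⊗ (pB ∘ lam Y))); rewrite lamB; diag.
  + rewrite <- (antipode_l2 (hcq_laws Y)); diag.
Qed.

(** For the coproduct, [cofact_1_lr] rebrackets [(u ⊗ u) ∘ delta Y] so that [pD] and then [pB] split
    off on the right. Each splitting is already known through [u]. *)
Lemma u_comagma_hom :
  comagma_hom Y (hcq_comagma (double_cross_coproduct B D rho r)) u.
Proof.
split; cbn [eps delta hcq_ob hcq_comagma double_cross_coproduct].
- typed.
- via (((eps D ∘ pD) ⊗ (eps B ∘ pB)) ∘ delta Y); rewrite epsD, epsB.
  via (eps Y ∘ ((eps Y ⊗ Y) ∘ delta Y)); rewrite counit_l; diag.
- rewrite Omega_Om; symmetry.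
  via ((u ⊗ D ⊗ B) ∘ ((Y ⊗ u) ∘ delta Y)); rewrite cofact_1_lr.
  via ((((u ⊗ pD) ∘ delta Y) ⊗ pB) ∘ delta Y); rewrite u_pD_delta.
  via ((ThD ⊗ B) ∘ ((u ⊗ pB) ∘ delta Y)); rewrite u_pB_delta; diag.
Qed.

Lemma double_cross_isomorphic :
  hcq_isomorphic Y (double_cross_coproduct B D rho r).
Proof.
exists u, w.
split; [exact (conj u_monoid_hom u_comagma_hom) | split; [split | easy]].
- exact (monoid_hom_inverse MY (tens_is_monoid MD MB) Tw wu uw u_monoid_hom).
- refine (comagma_hom_inverse _ _ _ Tw wu uw u_comagma_hom).
  + cbn [hcq_ob double_cross_coproduct]; typed.
  + cbn [delta hcq_ob hcq_comagma double_cross_coproduct]; rewrite Omega_Om; typed.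
  + cbn [eps hcq_ob hcq_comagma double_cross_coproduct].
    rewrite <- (tob_unit_l K); typed.
Qed.

End Forward.
(** * From comatched pairs to cofactorizations *)

Section Backward.

Variables (C : ssmcat) (Y D B : hopf_coquasigroup C).
Variables (rho r f g lD lB Om : mor C).
Hypothesis OmE : Om = Omega B D rho r.
Hypothesis cm : is_comatched_pair B D rho r.
Hypothesis Hf : hcq_hom Y (double_cross_coproduct B D rho r) f.
Hypotheses (Tg : hom (D ⊗ B) Y g) (gf : g ∘ f = Y) (fg : f ∘ g = (D ⊗ B)%ob).
Hypotheses (TlD : hom D D lD) (lDK : lD ∘ lam D = D).
Hypotheses (TlB : hom B B lB) (lBK : lB ∘ lam B = B).

Local Notation pD := ((D ⊗ eps B) ∘ f).
Local Notation pB := ((eps D ⊗ B) ∘ f).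

Let MD := hcq_is_monoid (hcq_laws D).
Let MB := hcq_is_monoid (hcq_laws B).
Let MY := hcq_is_monoid (hcq_laws Y).

Let Tf : hom Y (D ⊗ B) f.
Proof. exact (monoid_hom_typed (proj1 Hf)). Qed.

Let Trho : hom B (B ⊗ D) rho.
Proof. exact (rho_typed (cm_rho cm)). Qed.

Let Tr : hom D (B ⊗ D) r.
Proof. exact (r_typed (cm_r cm)). Qed.

Let TOm : hom (D ⊗ B) (B ⊗ D) Om.
Proof. rewrite OmE; unfold Omega; cbn [mu tens_monoid]; typed. Qed.

(** * The monoid morphism [Om] of a comatched pair and its compatibilities *)

Lemma coaction_rho_monoid_hom : monoid_hom B (tens_monoid B D) rho.
Proof.
split; [exact Trho | exact (rho_eta (cm_rho cm)) |].
rewrite (rho_mu (cm_rho cm)); cbn [mu tens_monoid]; diag.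
Qed.

Lemma coaction_r_monoid_hom : monoid_hom D (tens_monoid B D) r.
Proof.
split; [exact Tr | exact (r_eta (cm_r cm)) | exact (r_mu (cm_r cm))].
Qed.

Lemma matched_Om_monoid_hom : monoid_hom (tens_monoid D B) (tens_monoid B D) Om.
Proof.
rewrite OmE.
exact (commuting_monoid_homs MD MB (tens_is_monoid MB MD)
  coaction_r_monoid_hom coaction_rho_monoid_hom (cm_comm cm)).
Qed.

Lemma Om_unit_B : Om ∘ (D ⊗ eta B) = r.
Proof.
destruct (tens_is_monoid MB MD) as [Te Tm _ ur _].
rewrite OmE; unfold Omega.
via (mu (tens_monoid B D) ∘ (r ⊗ (rho ∘ eta B))).
rewrite (rho_eta (cm_rho cm)).
change (eta B ⊗ eta D) with (eta (tens_monoid B D)).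
via (mu (tens_monoid B D) ∘ ((B ⊗ D)%ob ⊗ eta (tens_monoid B D)) ∘ r).
rewrite ur; diag.
Qed.

Lemma Om_unit_D : Om ∘ (eta D ⊗ B) = rho.
Proof.
destruct (tens_is_monoid MB MD) as [Te Tm ul _ _].
rewrite OmE; unfold Omega.
via (mu (tens_monoid B D) ∘ ((r ∘ eta D) ⊗ rho)).
rewrite (r_eta (cm_r cm)).
change (eta B ⊗ eta D) with (eta (tens_monoid B D)).
via (mu (tens_monoid B D) ∘ (eta (tens_monoid B D) ⊗ (B ⊗ D)%ob) ∘ rho).
rewrite ul; diag.
Qed.

(** Two monoid morphisms on [D ⊗ B]: on [D] they agree by the counit law of [r], on [B] by
    [cm_rho_eps]. *)
Lemma matched_Om_eps_B : (eps B ⊗ D) ∘ Om = D ⊗ eps B.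
Proof.
apply (monoid_hom_tens_ext MD MB MD).
- exact (monoid_hom_comp (tens_is_monoid MD MB) (tens_is_monoid MB MD) MD
    matched_Om_monoid_hom (counit_l_monoid_hom B MD)).
- exact (counit_r_monoid_hom B MD).
- via ((eps B ⊗ D) ∘ (Om ∘ (D ⊗ eta B))); rewrite Om_unit_B, (r_counit (cm_r cm)).
  symmetry; via (D ⊗ (eps B ∘ eta B)); rewrite eps_eta; diag.
- via ((eps B ⊗ D) ∘ (Om ∘ (eta D ⊗ B))); rewrite Om_unit_D, (cm_rho_eps cm).
  diag.
Qed.

Lemma matched_Om_eps_D : (B ⊗ eps D) ∘ Om = eps D ⊗ B.
Proof.
apply (monoid_hom_tens_ext MD MB MB).
- exact (monoid_hom_comp (tens_is_monoid MD MB) (tens_is_monoid MB MD) MB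
    matched_Om_monoid_hom (counit_r_monoid_hom D MB)).
- exact (counit_l_monoid_hom D MB).
- via ((B ⊗ eps D) ∘ (Om ∘ (D ⊗ eta B))); rewrite Om_unit_B, (cm_r_eps cm).
  diag.
- via ((B ⊗ eps D) ∘ (Om ∘ (eta D ⊗ B))).
  rewrite Om_unit_D, (rho_counit (cm_rho cm)).
  symmetry; via ((eps D ∘ eta D) ⊗ B); rewrite eps_eta; diag.
Qed.

(** The condition [cm_rho_delta] with its antipodes cancelled by [lB] and [lD]. *)
Lemma delta_B_rho : (delta B ⊗ D) ∘ rho = (B ⊗ Om) ∘ (rho ⊗ B) ∘ delta B.
Proof.
pose proof (cm_rho_delta cm) as E; rewrite <- OmE in E.
apply (@cancel_retraction C B (B ⊗ B ⊗ D) (B ⊗ B ⊗ D)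
  (B ⊗ lam B ⊗ lam D) (B ⊗ lB ⊗ lD)); [typed | typed | | typed | typed |].
- via (B ⊗ (lB ∘ lam B) ⊗ (lD ∘ lam D)); rewrite lBK, lDK; diag.
- via ((B ⊗ lam B ⊗ lam D) ∘ (delta B ⊗ D) ∘ rho); rewrite E; diag.
Qed.

Lemma delta_D_r : (B ⊗ delta D) ∘ r = (Om ⊗ D) ∘ (D ⊗ r) ∘ delta D.
Proof.
pose proof (cm_r_delta cm) as E; rewrite <- OmE in E.
apply (@cancel_retraction C D (B ⊗ D ⊗ D) (B ⊗ D ⊗ D)
  (lam B ⊗ lam D ⊗ D) (lB ⊗ lD ⊗ D)); [typed | typed | | typed | typed |].
- via ((lB ∘ lam B) ⊗ (lD ∘ lam D) ⊗ D); rewrite lBK, lDK; diag.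
- via ((lam B ⊗ lam D ⊗ D) ∘ (B ⊗ delta D) ∘ r); rewrite E; diag.
Qed.

Lemma matched_delta_B_Om :
  (delta B ⊗ D) ∘ Om = (B ⊗ Om) ∘ (Om ⊗ B) ∘ (D ⊗ delta B).
Proof.
pose proof (tens_is_monoid MB MB) as MBB.
pose proof (tens_is_monoid MB MD) as MBD.
pose proof (tens_is_monoid MD MB) as MDB.
apply (monoid_hom_tens_ext MD MB (tens_is_monoid MB MBD)).
(* Each side is a composite of monoid morphisms, up to rebracketing triple tensors. *)
- apply (monoid_hom_assoc_cod _ _ MB MB MD).
  exact (monoid_hom_comp MDB MBD (tens_is_monoid MBB MD) matched_Om_monoid_hom
    (tens_monoid_hom MB MBB MD MD (delta_monoid_hom B) (monoid_hom_id MD))).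
- refine (monoid_hom_comp MDB (tens_is_monoid MD MBB) (tens_is_monoid MB MBD)
    (tens_monoid_hom MD MD MB MBB (monoid_hom_id MD) (delta_monoid_hom B)) _).
  apply (monoid_hom_assoc_dom _ _ MD MB MB).
  refine (monoid_hom_comp (tens_is_monoid MDB MB) (tens_is_monoid MB MDB)
    (tens_is_monoid MB MBD) _
    (tens_monoid_hom MB MB MDB MBD (monoid_hom_id MB) matched_Om_monoid_hom)).
  apply (monoid_hom_assoc_cod _ _ MB MD MB).
  exact (tens_monoid_hom MDB MBD MB MB matched_Om_monoid_hom (monoid_hom_id MB)).
(* On [D] the identity is the coassociativity of [r]; on [B] it is [delta_B_rho]. *)
- via ((delta B ⊗ D) ∘ (Om ∘ (D ⊗ eta B))); rewrite Om_unit_B.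
  rewrite <- (r_coassoc (cm_r cm)); symmetry.
  via ((B ⊗ Om) ∘ (Om ⊗ B) ∘ (D ⊗ (delta B ∘ eta B))); rewrite delta_eta.
  via ((B ⊗ Om) ∘ ((Om ∘ (D ⊗ eta B)) ⊗ eta B)); rewrite Om_unit_B.
  via ((B ⊗ (Om ∘ (D ⊗ eta B))) ∘ r); rewrite Om_unit_B; diag.
- via ((delta B ⊗ D) ∘ (Om ∘ (eta D ⊗ B))); rewrite Om_unit_D, delta_B_rho.
  rewrite <- Om_unit_D at 1; diag.
Qed.

Lemma matched_delta_D_Om :
  (B ⊗ delta D) ∘ Om = (Om ⊗ D) ∘ (D ⊗ Om) ∘ (delta D ⊗ B).
Proof.
pose proof (tens_is_monoid MD MD) as MDD.
pose proof (tens_is_monoid MB MD) as MBD.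
pose proof (tens_is_monoid MD MB) as MDB.
apply (monoid_hom_tens_ext MD MB (tens_is_monoid MBD MD)).
- apply (monoid_hom_assoc_cod _ _ MB MD MD).
  exact (monoid_hom_comp MDB MBD (tens_is_monoid MB MDD) matched_Om_monoid_hom
    (tens_monoid_hom MB MB MD MDD (monoid_hom_id MB) (delta_monoid_hom D))).
- refine (monoid_hom_comp MDB (tens_is_monoid MDD MB) (tens_is_monoid MBD MD)
    (tens_monoid_hom MD MDD MB MB (delta_monoid_hom D) (monoid_hom_id MB)) _).
  apply (monoid_hom_assoc_dom _ _ MD MD MB).
  refine (monoid_hom_comp (tens_is_monoid MD MDB) (tens_is_monoid MDB MD)
    (tens_is_monoid MBD MD) _
    (tens_monoid_hom MDB MBD MD MD matched_Om_monoid_hom (monoid_hom_id MD))).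
  apply (monoid_hom_assoc_cod _ _ MD MB MD).
  exact (tens_monoid_hom MD MD MDB MBD (monoid_hom_id MD) matched_Om_monoid_hom).
- via ((B ⊗ delta D) ∘ (Om ∘ (D ⊗ eta B))); rewrite Om_unit_B, delta_D_r.
  rewrite <- Om_unit_B at 1; diag.
- via ((B ⊗ delta D) ∘ (Om ∘ (eta D ⊗ B))); rewrite Om_unit_D.
  rewrite <- (rho_coassoc (cm_rho cm)); symmetry.
  via ((Om ⊗ D) ∘ (D ⊗ Om) ∘ ((delta D ∘ eta D) ⊗ B)); rewrite delta_eta.
  via ((Om ⊗ D) ∘ (eta D ⊗ (Om ∘ (eta D ⊗ B)))); rewrite Om_unit_D.
  via (((Om ∘ (eta D ⊗ B)) ⊗ D) ∘ rho); rewrite Om_unit_D; diag.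
Qed.

(** * The coproduct of [Y] read through [f] *)

Local Notation ThD := ((D ⊗ Om) ∘ (delta D ⊗ B)).
Local Notation ThB := ((Om ⊗ B) ∘ (D ⊗ delta B)).

Lemma f_delta : (f ⊗ f) ∘ delta Y = (D ⊗ Om ⊗ B) ∘ (delta D ⊗ delta B) ∘ f.
Proof. rewrite OmE; symmetry; exact (comagma_hom_delta (proj2 Hf)). Qed.

Lemma f_eps : eps Y = (eps D ⊗ eps B) ∘ f.
Proof. symmetry; exact (comagma_hom_eps (proj2 Hf)). Qed.

Lemma f_pD_delta : (f ⊗ pD) ∘ delta Y = ThD ∘ f.
Proof.
via ((D ⊗ B ⊗ D ⊗ eps B) ∘ ((f ⊗ f) ∘ delta Y)); rewrite f_delta.
via (ThD ∘ (D ⊗ ((B ⊗ eps B) ∘ delta B)) ∘ f); rewrite counit_r; diag.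
Qed.

Lemma f_pB_delta : (f ⊗ pB) ∘ delta Y = (D ⊗ delta B) ∘ f.
Proof.
via ((D ⊗ B ⊗ eps D ⊗ B) ∘ ((f ⊗ f) ∘ delta Y)); rewrite f_delta.
via ((D ⊗ ((B ⊗ eps D) ∘ Om) ⊗ B) ∘ (delta D ⊗ delta B) ∘ f).
rewrite matched_Om_eps_D.
via ((((D ⊗ eps D) ∘ delta D) ⊗ delta B) ∘ f); rewrite counit_r; diag.
Qed.

Lemma pB_f_delta : (pB ⊗ f) ∘ delta Y = ThB ∘ f.
Proof.
via ((eps D ⊗ B ⊗ D ⊗ B) ∘ ((f ⊗ f) ∘ delta Y)); rewrite f_delta.
via (ThB ∘ (((eps D ⊗ D) ∘ delta D) ⊗ B) ∘ f); rewrite counit_l; diag.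
Qed.

Lemma pD_f_delta : (pD ⊗ f) ∘ delta Y = (delta D ⊗ B) ∘ f.
Proof.
via ((D ⊗ eps B ⊗ D ⊗ B) ∘ ((f ⊗ f) ∘ delta Y)); rewrite f_delta.
via ((D ⊗ ((eps B ⊗ D) ∘ Om) ⊗ B) ∘ (delta D ⊗ delta B) ∘ f).
rewrite matched_Om_eps_B.
via ((delta D ⊗ ((eps B ⊗ B) ∘ delta B)) ∘ f); rewrite counit_l; diag.
Qed.

(** The isomorphism [f] is recovered from its two projections, so the arrow [u] of the
    cofactorization is [f] itself. *)
Lemma u_f : (pD ⊗ pB) ∘ delta Y = f.
Proof.
via ((D ⊗ eps B ⊗ B) ∘ ((f ⊗ pB) ∘ delta Y)); rewrite f_pB_delta.
via ((D ⊗ ((eps B ⊗ B) ∘ delta B)) ∘ f); rewrite counit_l; diag.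
Qed.

Lemma v_f : (pB ⊗ pD) ∘ delta Y = Om ∘ f.
Proof.
via ((eps D ⊗ B ⊗ D) ∘ ((f ⊗ pD) ∘ delta Y)); rewrite f_pD_delta.
via (Om ∘ (((eps D ⊗ D) ∘ delta D) ⊗ B) ∘ f); rewrite counit_l; diag.
Qed.

Let TpD : hom Y D pD.
Proof. rewrite <- (tob_unit_r D) at 1; typed. Qed.

Let TpB : hom Y B pB.
Proof. rewrite <- (tob_unit_l B) at 1; typed. Qed.

(** * The projections and the cofactorization axioms *)

Lemma projection_D_hom : hcq_hom Y D pD.
Proof.
split; [| split; [easy | |]].
- exact (monoid_hom_comp MY (tens_is_monoid MD MB) MD (proj1 Hf)
    (counit_r_monoid_hom B MD)).
- rewrite f_eps; diag.
- symmetry; via ((D ⊗ eps B ⊗ D) ∘ ((f ⊗ pD) ∘ delta Y)); rewrite f_pD_delta.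
  via ((D ⊗ ((eps B ⊗ D) ∘ Om)) ∘ (delta D ⊗ B) ∘ f); rewrite matched_Om_eps_B.
  diag.
Qed.

Lemma projection_B_hom : hcq_hom Y B pB.
Proof.
split; [| split; [easy | |]].
- exact (monoid_hom_comp MY (tens_is_monoid MD MB) MB (proj1 Hf)
    (counit_l_monoid_hom D MB)).
- rewrite f_eps; diag.
- symmetry; via ((eps D ⊗ B ⊗ B) ∘ ((f ⊗ pB) ∘ delta Y)); rewrite f_pB_delta.
  diag.
Qed.

(** A split epimorphism: the inclusion of [D] along the unit of [B], followed by [g], is a
    section. *)
Lemma projection_D_epi : is_epi pD.
Proof.
apply (@section_epi C Y D _ (g ∘ (D ⊗ eta B))).
- exact TpD.
- rewrite <- (tob_unit_r D) at 1; typed.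
- via ((D ⊗ eps B) ∘ (f ∘ g) ∘ (D ⊗ eta B)); rewrite fg.
  via (D ⊗ (eps B ∘ eta B)); rewrite eps_eta; diag.
Qed.

Lemma projection_B_epi : is_epi pB.
Proof.
apply (@section_epi C Y B _ (g ∘ (eta D ⊗ B))).
- exact TpB.
- rewrite <- (tob_unit_l B) at 1; typed.
- via ((eps D ⊗ B) ∘ (f ∘ g) ∘ (eta D ⊗ B)); rewrite fg.
  via ((eps D ∘ eta D) ⊗ B); rewrite eps_eta; diag.
Qed.

Lemma factorization : is_cofactorization Y D B pD pB.
Proof.
split.
- exact projection_D_hom.
- exact projection_D_epi.
- exact projection_B_hom.
- exact projection_B_epi.
- unfold cofact_u; rewrite u_f; destruct Tf as [fY fDB]; exists g.
  rewrite fY, fDB; easy.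
- unfold cofact_u; rewrite u_f.
  (* Composing the leg [Y] with [f], which has retraction [g], turns the axiom into an identity
     between arrows built from [delta D], [delta B] and [Om]. The other three axioms begin in the
     same way. *)
  apply (cancel_retraction (X := Y) (hom_tens Tf (hom_id (D ⊗ B)))
    (hom_tens Tg (hom_id (D ⊗ B)))); [| typed | typed |].
  { via ((g ∘ f) ⊗ (D ⊗ B)); rewrite gf; diag. }
  via ((f ⊗ f) ∘ delta Y); rewrite f_delta; symmetry.
  via ((((f ⊗ pD) ∘ delta Y) ⊗ pB) ∘ delta Y); rewrite f_pD_delta.
  via ((ThD ⊗ B) ∘ ((f ⊗ pB) ∘ delta Y)); rewrite f_pB_delta; diag.
- unfold cofact_u; rewrite u_f.
  apply (cancel_retraction (X := Y) (hom_tens (hom_id (D ⊗ B)) Tf)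
    (hom_tens (hom_id (D ⊗ B)) Tg)); [| typed | typed |].
  { via ((D ⊗ B) ⊗ (g ∘ f)); rewrite gf; diag. }
  via ((f ⊗ f) ∘ delta Y); rewrite f_delta; symmetry.
  via ((pD ⊗ ((pB ⊗ f) ∘ delta Y)) ∘ delta Y); rewrite pB_f_delta.
  via ((D ⊗ ThB) ∘ ((pD ⊗ f) ∘ delta Y)); rewrite pD_f_delta; diag.
- unfold cofact_v; rewrite v_f.
  apply (cancel_retraction (X := Y) (hom_tens Tf (hom_id (B ⊗ D)))
    (hom_tens Tg (hom_id (B ⊗ D)))); [| typed | typed |].
  { via ((g ∘ f) ⊗ (B ⊗ D)); rewrite gf; diag. }
  via ((D ⊗ B ⊗ ((lam B ⊗ lam D) ∘ Om)) ∘ ((f ⊗ f) ∘ delta Y)).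
  rewrite f_delta; symmetry.
  via ((D ⊗ B ⊗ lam B ⊗ lam D) ∘ (((f ⊗ pB) ∘ delta Y) ⊗ pD) ∘ delta Y).
  rewrite f_pB_delta.
  via ((D ⊗ B ⊗ lam B ⊗ lam D) ∘ (D ⊗ delta B ⊗ D) ∘ ((f ⊗ pD) ∘ delta Y)).
  rewrite f_pD_delta.
  (* The antipodes stay outermost, and the compatibility of [Om] with [delta B] does the
     rebracketing. *)
  via ((D ⊗ B ⊗ lam B ⊗ lam D) ∘ (D ⊗ ((delta B ⊗ D) ∘ Om)) ∘ (delta D ⊗ B) ∘ f).
  rewrite matched_delta_B_Om; diag.
- unfold cofact_v; rewrite v_f.
  apply (cancel_retraction (X := Y) (hom_tens (hom_id (B ⊗ D)) Tf)
    (hom_tens (hom_id (B ⊗ D)) Tg)); [| typed | typed |].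
  { via ((B ⊗ D) ⊗ (g ∘ f)); rewrite gf; diag. }
  via ((((lam B ⊗ lam D) ∘ Om) ⊗ D ⊗ B) ∘ ((f ⊗ f) ∘ delta Y)).
  rewrite f_delta; symmetry.
  via ((lam B ⊗ lam D ⊗ D ⊗ B) ∘ (pB ⊗ ((pD ⊗ f) ∘ delta Y)) ∘ delta Y).
  rewrite pD_f_delta.
  via ((lam B ⊗ lam D ⊗ D ⊗ B) ∘ (B ⊗ delta D ⊗ B) ∘ ((pB ⊗ f) ∘ delta Y)).
  rewrite pB_f_delta.
  via ((lam B ⊗ lam D ⊗ D ⊗ B) ∘ (((B ⊗ delta D) ∘ Om) ⊗ B) ∘ (D ⊗ delta B) ∘ f).
  rewrite matched_delta_D_Om; diag.
Qed.

End Backward.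

(** * The equivalence, assembled from the two directions *)

Theorem theorem4p12 (C : ssmcat) (D B Y : hopf_coquasigroup C)
    (lamD_iso : is_iso (lam D)) (lamB_iso : is_iso (lam B)) :
  cofactorizes Y D B <->
  exists rho r : mor C,
    is_comatched_pair B D rho r /\
    hcq_isomorphic Y (double_cross_coproduct B D rho r).
Proof.
destruct (iso_inverse (lam_typed (hcq_laws D)) lamD_iso) as [lD [TlD [lDK _]]].
destruct (iso_inverse (lam_typed (hcq_laws B)) lamB_iso) as [lB [TlB [lBK _]]].
split.
- intros [pD [pB fact]].
  pose proof (monoid_hom_typed (proj1 (cofact_pD_hom fact))) as TD.
  pose proof (monoid_hom_typed (proj1 (cofact_pB_hom fact))) as TB.
  assert (Tu : hom Y (D ⊗ B) ((pD ⊗ pB) ∘ delta Y)) by typed.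
  destruct (iso_inverse Tu (cofact_u_iso fact)) as [w [Tw [wu uw]]].
  (* Unification finds the coactions: the [eq_refl] below sets [Om] to [v ∘ w], and [rho] and [r]
     are its restrictions along the units. *)
  do 2 eexists; split.
  + exact (comatched fact Tw wu uw TlD lDK TlB lBK eq_refl).
  + exact (double_cross_isomorphic fact Tw wu uw eq_refl).
- intros [rho [r [cm [f [g [Hf [Hg [gf fg]]]]]]]].
  do 2 eexists.
  exact (factorization eq_refl cm Hf (monoid_hom_typed (proj1 Hg)) gf fg
    TlD lDK TlB lBK).
Qed.
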